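(* Let $P\Sigma_n$ be the basis-conjugating (pure symmetric) automorphism group of the free group $F_n$. There is $k_0$ such that for all $k\ge k_0$, \[ \theta_k(P\Sigma_n)=(k-1)\binom{n}{2}+(k^2-1)\binom{n}{3}. \]
   Context: $F_n$ is free on $x_1,\dots,x_n$; $P\Sigma_n$ is the group of automorphisms of $F_n$ sending each $x_i$ to a conjugate of itself; it has McCool's presentation with generators $\beta_{i,j}$ ($1\le i\ne j\le n$; $\beta_{i,j}(x_i)=x_j^{-1}x_ix_j$, $\beta_{i,j}(x_k)=x_k$ for $k\ne i$) and relators $[\beta_{i,j},\beta_{k,l}]$, $[\beta_{i,k},\beta_{j,k}]$, $[\beta_{i,j},\beta_{i,k}\beta_{j,k}]$ with distinct indices, where $[u,v]=uvu^{-1}v^{-1}$. The Chen ranks are $\theta_k(G)=\operatorname{rank}\mathrm{gr}_k(G/G'')$, the ranks of lower central series quotients of $G/G''$. *)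

(* Defs.v *)
From HB Require Import structures.
From mathcomp Require Import all_boot all_order all_algebra.
Set Implicit Arguments. Unset Strict Implicit. Unset Printing Implicit Defensive.

(* A letter (x, false) stands for x, (x, true) for x^-1. *)
Section FreeGroup.
Variable X : eqType.
Definition letter := (X * bool)%type.
Definition word := seq letter.

Fixpoint reduce (w : word) : word :=
  match w with
  | [::] => [::]
  | a :: w' =>
      match reduce w' with
      | b :: r => if (b.1 == a.1) && (b.2 == ~~ a.2) then r else a :: b :: r
      | [::] => [:: a]
      end
  end.

Definition FG : word -> Prop := fun w => reduce w = w.
Definition one : word := [::].
Definition mul (u v : word) : word := reduce (u ++ v).
Definition inv (w : word) : word :=
  reduce (rev (map (fun a : letter => (a.1, ~~ a.2)) w)).
Definition gen1 (x : X) : word := [:: (x, false)].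
Definition comm (u v : word) : word := mul (mul (mul u v) (inv u)) (inv v).
Definition powz (u : word) (c : int) : word :=
  match c with
  | Posz m => iter m (mul u) one
  | Negz m => iter m.+1 (mul (inv u)) one
  end.

Inductive gen (S : word -> Prop) : word -> Prop :=
| gen_one : gen S one
| gen_S w : S w -> gen S w
| gen_inv w : gen S w -> gen S (inv w)
| gen_mul u v : gen S u -> gen S v -> gen S (mul u v).

Definition commg (H K : word -> Prop) : word -> Prop :=
  gen (fun w => exists u v, H u /\ K v /\ w = comm u v).

Definition nclosure (R : word -> Prop) : word -> Prop :=
  gen (fun w => exists g r, FG g /\ R r /\ w = mul (mul g r) (inv g)).

(* lower central series of F(X): lcs 1 = F, lcs (k+1) = [F, lcs k] *)
Fixpoint lcs (k : nat) : word -> Prop :=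
  match k with
  | 0 => FG
  | k'.+1 => match k' with 0 => FG | _ => commg FG (lcs k') end
  end.

(* For G = F(X)/N with N = nclosure R, the preimage of G'' in F is N F''. *)
Definition second_derived_pre (R : word -> Prop) : word -> Prop :=
  gen (fun w => nclosure R w \/ commg (commg FG FG) (commg FG FG) w).

(* preimage in F of gamma_k(G/G'') *)
Definition chen_lcs_pre (R : word -> Prop) (k : nat) : word -> Prop :=
  gen (fun w => lcs k w \/ second_derived_pre R w).

Definition prodz (xs : seq word) (cs : seq int) : word :=
  foldr (fun p acc => mul (powz p.1 p.2) acc) one (zip xs cs).

Definition indep_mod (B : word -> Prop) (xs : seq word) : Prop :=
  forall cs : seq int, size cs = size xs -> B (prodz xs cs) ->
    forall c, c \in cs -> c = 0%R.

Definition has_rank (A B : word -> Prop) (r : nat) : Prop :=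
  (exists xs : seq word, size xs = r /\ (forall x, x \in xs -> A x) /\ indep_mod B xs)
  /\ (forall xs : seq word, size xs = r.+1 -> (forall x, x \in xs -> A x) ->
        ~ indep_mod B xs).

(* theta_k(G) = r for G = <X | R>:
   gr_k(G/G'') = gamma_k(G/G'')/gamma_{k+1}(G/G'') has rank r *)
Definition chen_rank_is (R : word -> Prop) (k r : nat) : Prop :=
  has_rank (chen_lcs_pre R k) (chen_lcs_pre R k.+1) r.
End FreeGroup.

Definition PSgen (n : nat) := {p : 'I_n * 'I_n | p.1 != p.2}.
Definition src n (a : PSgen n) : 'I_n := (val a).1.
Definition tgt n (a : PSgen n) : 'I_n := (val a).2.

Definition McCool_rel (n : nat) : word (PSgen n) -> Prop := fun w =>
  (exists a b : PSgen n,
     uniq [:: src a; tgt a; src b; tgt b] /\ w = comm (gen1 a) (gen1 b))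
  \/
  (exists a b : PSgen n,
     tgt a = tgt b /\ uniq [:: src a; src b; tgt a] /\ w = comm (gen1 a) (gen1 b))
  \/
  (exists a b c : PSgen n,
     src a = src b /\ tgt b = tgt c /\ tgt a = src c /\
     uniq [:: src a; tgt a; tgt b] /\
     w = comm (gen1 a) (mul (gen1 b) (gen1 c))).

(* Main.v *)
Require Import Defs.
From mathcomp Require Import all_boot all_order all_algebra.
From HB Require Import structures.
From mathcomp Require Import boolp zify ring.
Import Defs.
Set Implicit Arguments. Unset Strict Implicit. Unset Printing Implicit Defensive.
Import GRing.Theory Num.Theory.

(** * Free groups *)

Local Open Scope group_scope.

(** Put k = d + 2. In a metabelian group the derived subgroup is a module over the group ring of the
    abelianization. Modulo weight d + 3, its part of weight d + 2 is spanned by brackets [a, b] of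
    generators, multiplied by monomials of degree d in the commuting operators X_c = c - 1. Both
    McCool's relators and the Jacobi identity X_c [a, b] + X_a [b, c] + X_b [c, a] = 0 become linear
    relations there; [chen_system] collects them.

    Upper bound. Let Z_ijk = [beta_ij, beta_ik]; the relators give [beta_ij, beta_jk] = -Z_ijk in
    top degree. In large degree a letter with an index outside {i, j, k} kills Z_ijk, and X_at =
    -X_bt on it whenever {a, b, t} = {i, j, k} ([Zoutside_cons], [Zflip]). So only X_ki, X_ij, X_jk
    act, and Z_ijk, Z_jki, Z_kij satisfy one Koszul relation ([Zcyclic]). This is the shape of the
    Chen module of F_3, of rank k^2 - 1 for each triple. The corrected bracket H_ij =
    [beta_ij, beta_ji] + sum_m Z_mij is killed by all letters except X_ij and X_ji ([H0]), as for
    F_2, which gives k - 1 for each pair. Counting this spanning family ([span_chen],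
    [card_chen_index]) and eliminating over the integers yields [chen_upper].

    Lower bound. Each pair of indices gives a homomorphism to F_2 and each triple one to F_3
    ([pair_hom], [triple_hom]). They are composed with maps to affine groups over Z/m^(d+2), sending
    y_j to x |-> mu_j + (1 + m lam_j) x. There weight d + 3 dies, and the words [chen_word] become
    translations by m^(d+1) times explicit polynomials in lam and mu. These words are chosen so that
    each homomorphism sees only its own pair or triple. Letting m vary turns a dependence into
    integer identities; letting lam and mu vary turns these into polynomial identities, and all
    coefficients vanish ([pair_coef0], [triple_coef0]). *)

Section Words.
Variable X : eqType.
Implicit Types (a b : letter X) (u v w r : word X).

Definition flip a : letter X := (a.1, ~~ a.2).

Definition step a r : word X :=
  match r with
  | b :: r' => if (b.1 == a.1) && (b.2 == ~~ a.2) then r' else a :: r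
  | [::] => [:: a]
  end.

Lemma reduce_cons a w : reduce (a :: w) = step a (reduce w).
Proof. by rewrite /=; case: (reduce w). Qed.

Lemma flipK : involutive flip.
Proof. by case=> x e; rewrite /flip /= negbK. Qed.

Lemma step_cancel a r : step a (flip a :: r) = r.
Proof. by rewrite /step /= !eqxx. Qed.

Lemma stepP a r :
  (exists2 r', r = flip a :: r' & step a r = r') \/ step a r = a :: r.
Proof.
case: r => [|[y f] r]; first by right.
rewrite /step /=; case: (boolP (_ && _)) => [/andP [/eqP -> /eqP ->]|_]; last by right.
by left; exists r.
Qed.

Lemma size_reduce w : size (reduce w) <= size w.
Proof.
elim: w => // a w IH; rewrite reduce_cons /=.
have [[r' E ->]|->] := stepP a (reduce w); last by [].
by rewrite ltnW // ltnS (leq_trans _ IH) // E /=.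
Qed.

Lemma reduced_cons a r : reduce (a :: r) = a :: r ->
  reduce r = r /\ step a r = a :: r.
Proof.
move=> E; have E' := E; rewrite reduce_cons in E'.
have [[r' e1 e2]|e] := stepP a (reduce r).
  have := size_reduce r; rewrite e1 /= -e2 E' /=; lia.
by move: E'; rewrite e => -[e']; split=> //; rewrite -{1}e' e e'.
Qed.

(** Letters act on reduced words by permutations; this makes [reduce] compatible with concatenation
    and hence free multiplication associative. *)
Lemma step_flip a r : reduce r = r -> step (flip a) (step a r) = r.
Proof.
move=> rr; have [[r' e ->]|->] := stepP a r; last first.
  by rewrite -{2}(flipK a) step_cancel.
by subst r; have [_ ->] := reduced_cons rr.
Qed.

Lemma reduce_idem w : reduce (reduce w) = reduce w.
Proof.
elim: w => // a w IH; rewrite reduce_cons.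
have [[r' e ->]|e] := stepP a (reduce w).
  by move: IH; rewrite e => /reduced_cons [].
by rewrite e reduce_cons IH.
Qed.

Lemma reduce_cat u v : reduce (u ++ v) = foldr step (reduce v) u.
Proof. by elim: u => // a u IH; rewrite cat_cons reduce_cons IH. Qed.

Lemma reduce_catr u v : reduce (u ++ reduce v) = reduce (u ++ v).
Proof. by rewrite !reduce_cat reduce_idem. Qed.

Lemma reduce_catl u v : reduce (reduce u ++ v) = reduce (u ++ v).
Proof.
elim: u => // a u IH; rewrite cat_cons !reduce_cons -IH.
have [[r' -> ->]|->] := stepP a (reduce u); last by rewrite cat_cons reduce_cons.
rewrite cat_cons reduce_cons -{1}(flipK a) step_flip // reduce_idem //.
Qed.

Definition vinv w : word X := rev (map flip w).

Lemma invE w : inv w = reduce (vinv w). Proof. by []. Qed.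

Lemma vinv_cat u v : vinv (u ++ v) = vinv v ++ vinv u.
Proof. by rewrite /vinv map_cat rev_cat. Qed.

Lemma vinvK : involutive vinv.
Proof. by move=> w; rewrite /vinv map_rev revK (mapK flipK). Qed.

Lemma reduce_vinvl w : reduce (vinv w ++ w) = [::].
Proof.
elim: w => // a w IH; rewrite -cat1s vinv_cat -catA -reduce_catr.
have -> : reduce (vinv [:: a] ++ ([:: a] ++ w)) = reduce w.
  by rewrite [LHS]reduce_cons reduce_cons step_flip ?reduce_idem.
by rewrite reduce_catr.
Qed.

Lemma mul_reducel u v : mul (reduce u) v = mul u v.
Proof. exact: reduce_catl. Qed.

Lemma mul_reducer u v : mul u (reduce v) = mul u v.
Proof. exact: reduce_catr. Qed.

Lemma mulwA u v w : mul u (mul v w) = mul (mul u v) w.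
Proof. by rewrite /mul reduce_catr reduce_catl catA. Qed.

Lemma mul1w w : mul (one X) w = reduce w. Proof. by []. Qed.
Lemma mulw1 w : mul w (one X) = reduce w. Proof. by rewrite /mul cats0. Qed.

Lemma mulVw w : mul (inv w) w = one X.
Proof. by rewrite invE mul_reducel /mul reduce_vinvl. Qed.

Lemma FG_mul u v : FG (mul u v). Proof. exact: reduce_idem. Qed.
Lemma FG_inv u : FG (inv u). Proof. exact: reduce_idem. Qed.
Lemma FG_comm u v : FG (comm u v). Proof. exact: FG_mul. Qed.

Lemma FG_gen (S : word X -> Prop) w : (forall w', S w' -> FG w') -> gen S w -> FG w.
Proof.
move=> HS; elim=> {w} [//|w /HS //|w _ _|u v _ _ _ _]; first exact: FG_inv.
exact: FG_mul.
Qed.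

Lemma FG_commg (A B : word X -> Prop) w : commg A B w -> FG w.
Proof. by apply: FG_gen => w' [u [v [_ [_ ->]]]]; exact: FG_comm. Qed.

Lemma FG_lcs k w : lcs k w -> FG w.
Proof. by case: k => [|[|k]] //; exact: FG_commg. Qed.

Lemma FG_nclosure (A : word X -> Prop) w : nclosure A w -> FG w.
Proof. by apply: FG_gen => w' [g [r [_ [_ ->]]]]; exact: FG_mul. Qed.

Lemma FG_second (A : word X -> Prop) w : second_derived_pre A w -> FG w.
Proof. by apply: FG_gen => w' [/FG_nclosure|/FG_commg]. Qed.

Lemma FG_chen (A : word X -> Prop) k w : chen_lcs_pre A k w -> FG w.
Proof. by apply: FG_gen => w' [/FG_lcs|/FG_second]. Qed.

End Words.

(** * Evaluation of words in an arbitrary group *)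

Section Evaluation.
Variables (X : eqType) (G : groupType) (g : X -> G).
Implicit Types (u v w : word X).

Definition ev_letter (a : letter X) := if a.2 then (g a.1)^-1 else g a.1.
Definition ev w := foldr (fun a x => ev_letter a * x) 1 w.

Lemma ev_cat u v : ev (u ++ v) = ev u * ev v.
Proof. by elim: u => [|a u IH] /=; rewrite ?mul1g // IH mulgA. Qed.

Lemma ev_flip a : ev_letter (flip a) = (ev_letter a)^-1.
Proof. by case: a => x [] //=; rewrite /ev_letter /= invgK. Qed.

Lemma ev_reduce w : ev (reduce w) = ev w.
Proof.
elim: w => // a w IH; rewrite reduce_cons /= -IH.
have [[r -> ->]|->] := stepP a (reduce w); last by [].
by rewrite /= ev_flip mulVKg.
Qed.

Lemma ev_mul u v : ev (mul u v) = ev u * ev v.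
Proof. by rewrite ev_reduce ev_cat. Qed.

Lemma ev_inv w : ev (inv w) = (ev w)^-1.
Proof.
have := ev_mul (inv w) w; rewrite mulVw /= => /esym /mulg1_eq <-.
by rewrite invgK.
Qed.

Definition comg (x y : G) := x * y * x^-1 * y^-1.

Lemma ev_comm u v : ev (comm u v) = comg (ev u) (ev v).
Proof. by rewrite /comm !ev_mul !ev_inv. Qed.

Lemma ev_gen1 x : ev (gen1 x) = g x.
Proof. by rewrite /= mulg1. Qed.

Lemma ev_gen (S : word X -> Prop) (P : G -> Prop) w :
  P 1 -> (forall x, P x -> P x^-1) -> (forall x y, P x -> P y -> P (x * y)) ->
  (forall w', S w' -> P (ev w')) -> gen S w -> P (ev w).
Proof.
move=> P1 PV PM PS; elim=> {w} [//|w /PS //|w _ IH|u v _ IHu _ IHv].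
  by rewrite ev_inv; exact: PV.
by rewrite ev_mul; exact: PM.
Qed.

End Evaluation.

(** * Reduced words as a [groupType] *)

Section FreeGroupType.
Variable X : choiceType.

Record fgroup := Fgroup { fval : word X; _ : reduce fval == fval }.
HB.instance Definition _ := [isSub of fgroup for fval].
HB.instance Definition _ := [Choice of fgroup by <:].

Lemma reduce_subproof (w : word X) : reduce (reduce w) == reduce w.
Proof. by rewrite reduce_idem. Qed.

Definition fg (w : word X) : fgroup := Fgroup (reduce_subproof w).

Lemma fvalK (x : fgroup) : reduce (fval x) = fval x.
Proof. by case: x => w /= /eqP. Qed.

Lemma fgK (x : fgroup) : fg (fval x) = x.
Proof. by apply: val_inj => /=; exact: fvalK. Qed.

Definition fmul (x y : fgroup) := fg (fval x ++ fval y).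
Definition finv (x : fgroup) := fg (vinv (fval x)).

Lemma fmulA : associative fmul.
Proof. by move=> x y z; apply: val_inj => /=; exact: mulwA. Qed.
Lemma fmul1 : left_id (fg [::]) fmul.
Proof. by move=> x; apply: val_inj => /=; exact: fvalK. Qed.
Lemma fmul1r : right_id (fg [::]) fmul.
Proof. by move=> x; apply: val_inj; rewrite /= cats0; exact: fvalK. Qed.
Lemma fmulV : left_inverse (fg [::]) finv fmul.
Proof. by move=> x; apply: val_inj => /=; exact: mulVw. Qed.
Lemma fmulrV : right_inverse (fg [::]) finv fmul.
Proof.
move=> x; apply: val_inj => /=; rewrite reduce_catr -{1}[fval x]vinvK.
exact: reduce_vinvl.
Qed.
HB.instance Definition _ := isGroup.Build fgroup fmulA fmul1 fmul1r fmulV fmulrV.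

Lemma fval_mul (x y : fgroup) : fval (x * y) = mul (fval x) (fval y).
Proof. by []. Qed.
Lemma fval_inv (x : fgroup) : fval x^-1 = inv (fval x).
Proof. by []. Qed.
Lemma fval_one : fval 1 = one X. Proof. by []. Qed.
Lemma fgM u v : fg (mul u v) = fg u * fg v.
Proof. by apply: val_inj; rewrite /= reduce_catl reduce_catr reduce_idem. Qed.
Lemma fgE w : FG w -> fval (fg w) = w. Proof. by []. Qed.

Lemma fgV w : fg (inv w) = (fg w)^-1.
Proof.
have := fgM (inv w) w; rewrite mulVw => /esym H.
by rewrite -(mulg1_eq H) invgK.
Qed.
End FreeGroupType.

(** * Quotients by normal subgroups *)

Section Quotient.
Variable G : groupType.

Record normal_pred := NormalPred {
  npred :> pred G;
  npred1 : npred 1;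
  npredM : forall x y, npred x -> npred y -> npred (x * y);
  npredV : forall x, npred x -> npred x^-1;
  npredJ : forall x y, npred x -> npred (y * x * y^-1) }.

Variable N : normal_pred.

Definition coset_rel (x y : G) := N (x * y^-1).

Lemma coset_refl : reflexive coset_rel.
Proof. by move=> x; rewrite /coset_rel mulgV npred1. Qed.

Lemma coset_sym : symmetric coset_rel.
Proof.
by move=> x y; apply/idP/idP => /npredV; rewrite /coset_rel invgM invgK.
Qed.

Lemma coset_trans : transitive coset_rel.
Proof.
by move=> y x z xy yz; have := npredM xy yz; rewrite mulgA mulgVK.
Qed.

Canonical coset_equiv := EquivRel coset_rel coset_refl coset_sym coset_trans.
Definition quot := {eq_quot coset_equiv}%qT.
HB.instance Definition _ := Choice.on quot.
HB.instance Definition _ := EqQuotient.on quot.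

Definition proj (x : G) : quot := (\pi_quot x)%qT.

Lemma proj_eq x y : (proj x == proj y) = N (x * y^-1).
Proof. exact: eqmodE. Qed.

Lemma reprqK (x : quot) : proj (repr x) = x.
Proof. exact: reprK. Qed.

Definition qmul (x y : quot) := proj (repr x * repr y).
Definition qinv (x : quot) := proj (repr x)^-1.

Lemma projM x y : proj (x * y) = qmul (proj x) (proj y).
Proof.
apply/eqP; rewrite proj_eq.
set x' := repr (proj x); set y' := repr (proj y).
have xx : N (x * x'^-1) by rewrite -proj_eq reprqK.
have yy : N (y * y'^-1) by rewrite -proj_eq reprqK.
have := npredM (npredJ x yy) xx.
by rewrite invgM !mulgA mulgVK.
Qed.

Lemma qmulA : associative qmul.
Proof.
by move=> x y z; rewrite -(reprqK x) -(reprqK y) -(reprqK z) -!projM mulgA.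
Qed.
Lemma qmul1 : left_id (proj 1) qmul.
Proof. by move=> x; rewrite -(reprqK x) -projM mul1g. Qed.
Lemma qmul1r : right_id (proj 1) qmul.
Proof. by move=> x; rewrite -(reprqK x) -projM mulg1. Qed.
Lemma qmulV : left_inverse (proj 1) qinv qmul.
Proof. by move=> x; rewrite -{2}(reprqK x) -projM mulVg. Qed.
Lemma qmulrV : right_inverse (proj 1) qinv qmul.
Proof. by move=> x; rewrite -{1}(reprqK x) -projM mulgV. Qed.
HB.instance Definition _ := isGroup.Build quot qmulA qmul1 qmul1r qmulV qmulrV.

End Quotient.

Lemma quotient_exists (G : groupType) (N : normal_pred G) :
  exists (Q : groupType) (p : G -> Q),
    [/\ forall x y, p (x * y) = p x * p y, forall x, p x = 1 <-> N x
      & forall y, exists x, y = p x].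
Proof.
exists (quot N), (@proj G N); split; first exact: projM.
  move=> x; have := proj_eq N x 1; rewrite invg1 mulg1 => <-.
  by split=> [->|/eqP].
by move=> y; exists (repr y); rewrite reprqK.
Qed.

(** * Normality of the subgroups defined by predicates on words *)

Section Normality.
Variable X : choiceType.
Implicit Types (u v w g : word X) (S : word X -> Prop).

Lemma fg_inj u v : FG u -> FG v -> fg u = fg v -> u = v.
Proof. by move=> Fu Fv E; rewrite -(fgE Fu) -(fgE Fv) E. Qed.

Definition cj g w := mul (mul g w) (inv g).

Lemma FG_cj g w : FG (cj g w). Proof. exact: FG_mul. Qed.

Lemma fg_cj g w : fg (cj g w) = fg g * fg w * (fg g)^-1.
Proof. by rewrite !fgM fgV. Qed.

Lemma fg_comm u v : fg (comm u v) = comg (fg u) (fg v).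
Proof. by rewrite !fgM !fgV. Qed.

Lemma cj_comm g u v : cj g (comm u v) = comm (cj g u) (cj g v).
Proof.
apply: fg_inj; [exact: FG_cj|exact: FG_comm|].
rewrite fg_comm !fg_cj fg_comm /comg !invgM !invgK.
by rewrite !mulgA !mulgVK.
Qed.

Definition conj_closed S := forall g w, FG g -> S w -> S (cj g w).

Lemma conj_closed_gen S : (forall w, S w -> FG w) -> conj_closed S ->
  conj_closed (gen S).
Proof.
move=> SF Sc g w Fg; elim=> {w} [|w Sw|w Gw IH|u v Gu IHu Gv IHv].
- have -> : cj g (one X) = one X; last exact: gen_one.
  apply: fg_inj; [exact: FG_cj|by []|rewrite fg_cj]; apply/eqP; by rewrite mulg_eq1 invgK mulg1.
- by apply: gen_S; apply: Sc.
- have -> : cj g (inv w) = inv (cj g w); last exact: gen_inv.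
  apply: fg_inj; [exact: FG_cj|exact: FG_inv|].
  by rewrite fg_cj !fgV fg_cj !invgM invgK mulgA.
have -> : cj g (mul u v) = mul (cj g u) (cj g v); last exact: gen_mul.
apply: fg_inj; [exact: FG_cj|exact: FG_mul|].
by rewrite fg_cj (fgM u v) (fgM (cj g u)) !fg_cj !mulgA mulgVK.
Qed.

Lemma conj_closed_FG : conj_closed (@FG X).
Proof. by move=> g w _ _; exact: FG_cj. Qed.

Lemma conj_closed_commg S1 S2 : conj_closed S1 -> conj_closed S2 ->
  conj_closed (commg S1 S2).
Proof.
move=> c1 c2; apply: conj_closed_gen => [w [u [v [_ [_ ->]]]]|g w Fg [u [v [Su [Sv ->]]]]].
  exact: FG_comm.
by exists (cj g u), (cj g v); rewrite cj_comm; do !split; auto.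
Qed.

Lemma conj_closed_lcs k : conj_closed (@lcs X k).
Proof.
elim: k => [|[|k] IH]; try exact: conj_closed_FG.
by apply: (@conj_closed_commg (@FG X) (@lcs X k.+1)); first exact: conj_closed_FG.
Qed.

Lemma conj_closed_nclosure S : conj_closed (nclosure S).
Proof.
apply: conj_closed_gen => [w [g [r [_ [_ ->]]]]|h w Fh [g [r [Fg [Sr ->]]]]].
  exact: FG_mul.
exists (mul h g), r; do !split=> //; first exact: FG_mul.
apply: fg_inj; [exact: FG_cj|exact: FG_mul|].
by rewrite fg_cj -!/(cj _ _) !fg_cj fgM invgM !mulgA.
Qed.

Lemma conj_closed_second S : conj_closed (second_derived_pre S).
Proof.
apply: conj_closed_gen => [w [/FG_nclosure|/FG_commg]|] // g w Fg [nw|cw].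
  by left; exact: conj_closed_nclosure.
by right; do !apply: conj_closed_commg; try exact: conj_closed_FG.
Qed.

(** Conjugation-closed generators generate a normal subgroup, so [gen S] is the kernel of evaluation
    in an actual group. The upper bound is argued in that group and carried back to words through
    this equivalence. *)
Lemma gen_quotient S : (forall w, S w -> FG w) -> conj_closed S ->
  exists (Q : groupType) (g : X -> Q),
    (forall w, FG w -> ev g w = 1 <-> gen S w) /\
    (forall x, exists w, FG w /\ x = ev g w).
Proof.
move=> SF Sc.
(* Quotient types need a Boolean relation; classical reflection supplies one. *)
pose N0 (x : fgroup X) := `[< gen S (fval x) >].
have N1 : N0 1 by apply/asboolP; exact: gen_one.
have NM x y : N0 x -> N0 y -> N0 (x * y).
  by move=> /asboolP ? /asboolP ?; apply/asboolP; exact: gen_mul.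
have NV x : N0 x -> N0 x^-1.
  by move=> /asboolP ?; apply/asboolP; exact: gen_inv.
have NJ x y : N0 x -> N0 (y * x * y^-1).
  move=> /asboolP ?; apply/asboolP; rewrite !fval_mul.
  by apply: conj_closed_gen => //; exact: fvalK.
have [Q [p [pM pN ps]]] := quotient_exists (NormalPred N1 NM NV NJ).
exists Q, (fun x => p (fg (gen1 x))).
have p1 : p 1 = 1 by apply/pN.
have pV x : p x^-1 = (p x)^-1.
  by have := pM x x^-1; rewrite mulgV p1 => /esym /mulg1_eq ->.
have evE w : ev (fun x => p (fg (gen1 x))) w = p (fg w).
  elim: w => [|a w IH] /=; first by rewrite -[LHS]p1; congr p; apply: val_inj.
  rewrite IH; have -> : fg (a :: w) = fg [:: a] * fg w.
    by apply: val_inj; symmetry; exact: (reduce_catr [:: a] w).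
  rewrite pM; congr (_ * _); case: a => x [] //; rewrite /ev_letter /= -pV.
  by congr p; rewrite -fgV.
split=> [w Fw|x].
  rewrite evE; split=> [/pN/asboolP|gw]; first by rewrite fgE.
  by apply/pN/asboolP; rewrite fgE.
have [y ->] := ps x; exists (fval y); split; first exact: fvalK.
by rewrite evE fgK.
Qed.
End Normality.

Local Close Scope group_scope.

(** * The Chen module *)

Local Open Scope ring_scope.

(** Read (i, j) as beta_ij, (i, i) as 1, and [f a b w] as [a, b] multiplied by the product of X_c
    over the letters c of [w]. The last three fields are McCool's relators to leading order, and
    [cs_jacobi] is the Jacobi identity of a metabelian group. *)
Record chen_system (I : finType) (V : zmodType)
    (f : I * I -> I * I -> seq (I * I) -> V) : Prop := ChenSystem {
  cs_perm : forall a b w w', perm_eq w w' -> f a b w = f a b w';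
  cs_alt : forall a w, f a a w = 0;
  cs_anti : forall a b w, f a b w = - f b a w;
  cs_diag : forall i b w, f (i, i) b w = 0;
  cs_diag_cons : forall a b i w, f a b ((i, i) :: w) = 0;
  cs_jacobi : forall a b c w,
    f a b (c :: w) + f b c (a :: w) + f c a (b :: w) = 0;
  cs_disj : forall i j k l w, uniq [:: i; j; k; l] -> f (i, j) (k, l) w = 0;
  cs_target : forall i j k w, uniq [:: i; j; k] -> f (i, k) (j, k) w = 0;
  cs_path : forall i j k w, uniq [:: i; j; k] ->
    f (i, j) (i, k) w + f (i, j) (j, k) w = 0 }.

Ltac distinct :=
  repeat match goal with
  | U : is_true (uniq _) |- _ =>
      move: U; rewrite /= ?inE ?negb_or ?andbT => U
  end;
  repeat match goal with U : is_true (_ && _) |- _ => case/andP: U => ? ? end;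
  rewrite /= ?inE ?negb_or ?andbT;
  repeat (apply/andP; split);
  first [assumption | rewrite eq_sym; assumption].

Lemma perm_flatten_nseq (T : eqType) (L w : seq T) : uniq L ->
  all (mem L) w -> perm_eq w (flatten [seq nseq (count_mem x w) x | x <- L]).
Proof.
move=> uL /allP wL; apply/allP => x; rewrite mem_cat /= => xP.
have xL : x \in L.
  case/orP: xP => [/wL //|/flattenP [s /mapP [y yL ->]]].
  by rewrite mem_nseq => /andP [_ /eqP ->].
rewrite count_flatten sumnE !big_map (bigD1_seq x) //= count_nseq /= eqxx mul1n.
by rewrite big1 ?addn0 // => y /negPf yx; rewrite count_nseq /= yx mul0n.
Qed.

Section ChenSystem.
Variables (I : finType) (V : zmodType) (f : I * I -> I * I -> seq (I * I) -> V).
Hypothesis fP : chen_system f.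
Implicit Types (i j k l m p q : I) (a b c : I * I) (w : seq (I * I)).

(** The bracket Z_ijk. By [path_Z] and [path_Z'] it also accounts for the brackets of beta_ij with
    beta_jk. *)
Definition sbr i j k w := f (i, j) (i, k) w.

Lemma Zperm i j k w w' : perm_eq w w' -> sbr i j k w = sbr i j k w'.
Proof. exact: cs_perm fP _ _ _ _. Qed.

Lemma Zswap i j k a b w : sbr i j k (a :: b :: w) = sbr i j k (b :: a :: w).
Proof. by apply: Zperm; apply/permP => r /=; rewrite addnCA. Qed.

Lemma Zanti i j k w : sbr i j k w = - sbr i k j w.
Proof. exact: cs_anti fP _ _ _. Qed.

Lemma path_Z i j k w : uniq [:: i; j; k] -> f (i, j) (j, k) w = - sbr i j k w.
Proof. by move=> U; apply/eqP; rewrite -addr_eq0 addrC (cs_path fP). Qed.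

Lemma path_Z' i j k w : uniq [:: i; j; k] -> f (j, k) (i, j) w = sbr i j k w.
Proof. by move=> U; rewrite (cs_anti fP) path_Z ?opprK. Qed.

(** Jacobi for beta_ij, beta_kj, beta_ik: the first two commute, and the other two brackets are both
    Z_ikj. *)
Lemma Zfst i j k w : uniq [:: i; j; k] ->
  sbr i j k ((k, j) :: w) = - sbr i j k ((i, j) :: w).
Proof.
move=> U; have := cs_jacobi fP (i, j) (k, j) (i, k) w.
rewrite (cs_target fP); last by distinct.
rewrite path_Z'; last by distinct.
rewrite add0r -/(sbr i k j _) !(Zanti i k j) => /eqP.
by rewrite addr_eq0 => /eqP /oppr_inj ->; rewrite opprK.
Qed.

Lemma Zsnd i j k w : uniq [:: i; j; k] ->
  sbr i j k ((j, k) :: w) = - sbr i j k ((i, k) :: w).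
Proof.
by move=> U; rewrite Zanti [X in _ = - X]Zanti Zfst //; distinct.
Qed.

(** Jacobi around the cycle beta_ij, beta_jk, beta_ki. This is the Koszul relation that ties
    together the three brackets of a triple. *)
Lemma Zcyclic i j k w : uniq [:: i; j; k] ->
  sbr i j k ((k, i) :: w) + sbr j k i ((i, j) :: w) + sbr k i j ((j, k) :: w) = 0.
Proof.
move=> U; have := cs_jacobi fP (i, j) (j, k) (k, i) w.
rewrite !path_Z; try by distinct.
by rewrite -!opprD => /eqP; rewrite oppr_eq0 => /eqP.
Qed.

Lemma Zout i j k l m w : uniq [:: i; j; k; l; m] -> sbr i j k ((l, m) :: w) = 0.
Proof.
move=> U; have := cs_jacobi fP (i, j) (i, k) (l, m) w.
by rewrite (cs_disj fP (i:=i)(j:=k)) ?(cs_disj fP (i:=l)(j:=m)) ?addr0 //; distinct.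
Qed.

Lemma ZA i j k l w : uniq [:: i; j; k; l] -> sbr i j k ((l, k) :: w) = 0.
Proof.
move=> U; have := cs_jacobi fP (i, j) (i, k) (l, k) w.
by rewrite (cs_target fP (i:=i)(j:=l)) ?(cs_disj fP (i:=l)) ?addr0 //; distinct.
Qed.

Lemma ZA' i j k l w : uniq [:: i; j; k; l] -> sbr i j k ((l, j) :: w) = 0.
Proof. by move=> U; rewrite Zanti ZA ?oppr0 //; distinct. Qed.

(** With a fourth index l, Jacobi loses one term because beta_jk and beta_li commute, so the letter
    moves the bracket to another triple. [ZC2], [ZD1] and [ZD3] are further such moves; in [Zout]
    and [ZA] two terms vanish and the letter kills. *)
Lemma ZB2 i j k l w : uniq [:: i; j; k; l] ->
  sbr i j k ((l, i) :: w) = - sbr l i j ((j, k) :: w).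
Proof.
move=> U; have := cs_jacobi fP (i, j) (j, k) (l, i) w.
rewrite (path_Z (i:=i)) ?(cs_disj fP (i:=j)) ?(path_Z (i:=l)); try by distinct.
by rewrite addr0 -opprD => /eqP; rewrite oppr_eq0 addr_eq0 => /eqP.
Qed.

Lemma ZB3 i j k l w : uniq [:: i; j; k; l] ->
  sbr i j k ((l, i) :: w) = sbr l i k ((k, j) :: w).
Proof. by move=> U; rewrite Zanti ZB2 ?opprK //; distinct. Qed.

Lemma ZC2 i j k l w : uniq [:: i; j; k; l] ->
  sbr i j k ((i, l) :: w) = sbr i l j ((j, k) :: w).
Proof.
move=> U; have := cs_jacobi fP (i, j) (j, k) (i, l) w.
rewrite (path_Z (i:=i)) ?(cs_disj fP (i:=j)); try by distinct.
by rewrite addr0 addrC => /eqP; rewrite subr_eq0 => /eqP.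
Qed.

Lemma ZC3 i j k l w : uniq [:: i; j; k; l] ->
  sbr i j k ((i, l) :: w) = sbr i k l ((k, j) :: w).
Proof. by move=> U; rewrite Zanti ZC2 -?Zanti //; distinct. Qed.

Lemma ZD1 i j k l w : uniq [:: i; j; k; l] ->
  sbr i j k ((j, l) :: w) = - sbr i j l ((i, k) :: w).
Proof.
move=> U; have := cs_jacobi fP (i, j) (i, k) (j, l) w.
rewrite (cs_disj fP (i:=i)(j:=k)) ?path_Z'; try by distinct.
by rewrite addr0 => /eqP; rewrite addr_eq0 => /eqP.
Qed.

Lemma ZD3 i j k l w : uniq [:: i; j; k; l] ->
  sbr i j k ((j, l) :: w) = sbr k j l ((i, k) :: w).
Proof.
move=> U; have := cs_jacobi fP (i, k) (k, j) (j, l) w.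
rewrite (cs_disj fP (i:=j)(j:=l)) ?path_Z; try by distinct.
by rewrite addr0 -Zanti => /eqP; rewrite subr_eq0 => /eqP.
Qed.

(* In degree one above [sbr i j k ((j, l) :: _)], only the letters
   (j, i), (k, i) and (l, i) act nontrivially. *)
Lemma ZD_letter i j k l p q w : uniq [:: i; j; k; l] ->
  ~~ ((q == i) && (p \in [:: j; k; l])) -> sbr i j k ((j, l) :: (p, q) :: w) = 0.
Proof.
move=> U.
have [-> _|npq] := eqVneq p q; first by rewrite Zswap /sbr (cs_diag_cons fP).
have jk0 : sbr i j k ((j, l) :: (j, k) :: w) = 0.
  rewrite ZD1 // Zswap ZD1; last by distinct.
  rewrite opprK ZC3 // Zswap -[LHS]opprK -Zfst; last by distinct.
  rewrite Zswap -(ZC3 (j := j)) //.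
  by rewrite Zswap ZA ?oppr0 //; distinct.
have [pi|pi] := eqVneq p i.
  subst p; move=> _.
  have [qm|] := boolP (q \in [:: j; k; l]); last first.
    rewrite !inE !negb_or => /and3P [? ? ?].
    by rewrite ZD3 // Zswap Zout //; distinct.
  move: qm; rewrite !inE => /or3P [] /eqP ->.
  - by rewrite ZD3 // Zswap ZA' //; distinct.
  - rewrite Zswap -[LHS]opprK -Zsnd; last by distinct.
    by rewrite Zswap jk0 oppr0.
  - by rewrite ZD3 // Zswap ZA //; distinct.
have [pj|pj] := eqVneq p j.
  subst p; have [->|qi] := eqVneq q i; first by rewrite !inE !eqxx.
  move=> _; have [->//|qk] := eqVneq q k.
  have [->|ql] := eqVneq q l.
    rewrite ZD1 // Zswap Zsnd ?opprK; last by distinct.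
    by rewrite Zswap -[LHS]opprK -ZD1 // ZD3 // Zswap ZA ?oppr0 //; distinct.
  rewrite ZD3 // Zswap ZD3; last by distinct.
  by rewrite Zswap Zout //; distinct.
have [pk|pk] := eqVneq p k.
  subst p; have [->|qi] := eqVneq q i; first by rewrite !inE !eqxx orbT.
  move=> _; rewrite ZD1 // Zswap.
  have [->|qj] := eqVneq q j; first by rewrite ZA' ?oppr0 //; distinct.
  have [->|ql] := eqVneq q l; first by rewrite ZA ?oppr0 //; distinct.
  by rewrite Zout ?oppr0 //; distinct.
have [pl|pl] := eqVneq p l.
  subst p; have [->|qi] := eqVneq q i; first by rewrite !inE !eqxx !orbT.
  move=> _; rewrite Zswap.
  have [->|qj] := eqVneq q j; first by rewrite ZA' //; distinct.
  have [->|qk] := eqVneq q k; first by rewrite ZA //; distinct.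
  by rewrite Zout //; distinct.
move=> _; have [->|qi] := eqVneq q i.
  by rewrite ZD3 // Zswap Zout //; distinct.
have [->|ql] := eqVneq q l.
  by rewrite ZD1 // Zswap ZA ?oppr0 //; distinct.
rewrite Zswap; have [->|qj] := eqVneq q j; first by rewrite ZA' //; distinct.
have [->|qk] := eqVneq q k; first by rewrite ZA //; distinct.
by rewrite Zout //; distinct.
Qed.

(** After [ZD_letter], nine products of letters among (j, i), (k, i), (l, i) remain. Each is moved
    to another triple where [ZA] or [ZA'] kills it, or is turned by [Zfst] into a product already
    killed. *)
Lemma ZD0 i j k l a b w : uniq [:: i; j; k; l] ->
  sbr i j k ((j, l) :: a :: b :: w) = 0.
Proof.
case: a => p q; case: b => p' q' U.
have [/andP [/eqP -> pP]|] := boolP ((q == i) && (p \in [:: j; k; l])); last first.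
  exact: ZD_letter.
have -> : sbr i j k ((j, l) :: (p, i) :: (p', q') :: w)
        = sbr i j k ((j, l) :: (p', q') :: (p, i) :: w).
  by apply: Zperm; apply/permP => r /=; congr addn; rewrite addnCA.
have [/andP [/eqP -> p'P]|] := boolP ((q' == i) && (p' \in [:: j; k; l])); last first.
  exact: ZD_letter.
have sym r s : sbr i j k [:: (j, l), (r, i), (s, i) & w] = 0 ->
    sbr i j k [:: (j, l), (s, i), (r, i) & w] = 0.
  by move=> <-; apply: Zperm; apply/permP => x /=; congr addn; rewrite addnCA.
have lj : sbr i j k [:: (j, l), (l, i), (j, i) & w] = 0.
  rewrite Zswap ZB3 //.
  rewrite (Zperm _ _ _ (w' := (j, i) :: (k, j) :: (j, l) :: w)); last first.
    by apply/permP => x /=; lia.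
  by rewrite ZA' //; distinct.
have lk : sbr i j k [:: (j, l), (l, i), (k, i) & w] = 0.
  rewrite Zswap ZB2 //.
  rewrite (Zperm _ _ _ (w' := (k, i) :: (j, k) :: (j, l) :: w)); last first.
    by apply/permP => x /=; lia.
  by rewrite ZA' ?oppr0 //; distinct.
have ll : sbr i j k [:: (j, l), (l, i), (l, i) & w] = 0.
  rewrite Zswap ZB3 //.
  rewrite (Zperm _ _ _ (w' := (l, i) :: (k, j) :: (j, l) :: w)); last first.
    by apply/permP => x /=; lia.
  rewrite -[LHS]opprK -Zfst; last by distinct.
  rewrite (Zperm _ _ _ (w' := (k, j) :: (j, l) :: (k, i) :: w)); last first.
    by apply/permP => x /=; lia.
  by rewrite -ZB3 // Zswap lk oppr0.
have ji x : sbr i j k [:: (j, l), (j, i), x & w] = sbr k i j [:: x, (k, l), (i, k) & w].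
  rewrite ZD3 // Zswap ZD1; last by distinct.
  by rewrite -Zanti; apply: Zperm; apply/permP => r /=; lia.
have jj : sbr i j k [:: (j, l), (j, i), (j, i) & w] = 0.
  rewrite ji Zswap ZC2; last by distinct.
  rewrite (Zperm _ _ _ (w' := (j, i) :: (i, j) :: (i, k) :: w)); last first.
    by apply/permP => x /=; lia.
  by rewrite ZA //; distinct.
have jk : sbr i j k [:: (j, l), (j, i), (k, i) & w] = 0.
  rewrite ji -[LHS]opprK -Zfst; last by distinct.
  by rewrite -ji jj oppr0.
have kk : sbr i j k [:: (j, l), (k, i), (k, i) & w] = 0.
  rewrite ZD1 // Zswap ZB3; last by distinct.
  rewrite (Zperm _ _ _ (w' := (k, i) :: (l, j) :: (i, k) :: w)); last first.
    by apply/permP => x /=; lia.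
  rewrite -Zfst; last by distinct.
  rewrite (Zperm _ _ _ (w' := (l, j) :: (i, k) :: (l, i) :: w)); last first.
    by apply/permP => x /=; lia.
  rewrite -ZB3; last by distinct.
  by rewrite Zswap -[LHS]opprK -ZD1 // (sym l k) ?oppr0.
by move: pP p'P; rewrite !inE => /or3P [] /eqP -> /or3P [] /eqP ->; auto.
Qed.

Definition outside i j k c := (c.1 \notin [:: i; j; k]) || (c.2 \notin [:: i; j; k]).

(** The letters that [ZA], [ZA'] and [Zout] do not kill outright are brought by [ZB2], [ZC2] or
    antisymmetry to the form of [ZD0]. That lemma consumes two more letters, hence the bound on the
    size of [w]. *)
Lemma Zoutside_cons i j k c w : uniq [:: i; j; k] -> outside i j k c ->
  (1 < size w)%N -> sbr i j k (c :: w) = 0.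
Proof.
case: c => p q U; case: w => [|a [|b w]] // + _.
have [->|npq] := eqVneq p q; first by rewrite /sbr (cs_diag_cons fP).
rewrite /outside /= !inE.
have [pE|pi] := eqVneq p i.
  subst p.
  have [?|qi] := eqVneq q i; first by subst; rewrite eqxx in npq.
  have [?|qj] := eqVneq q j; first by subst.
  have [?|qk _] := eqVneq q k; first by subst.
  by rewrite ZC2 ?(Zanti i q) ?ZD0 ?oppr0 //; distinct.
have [pE|pj] := eqVneq p j.
  subst p.
  have [?|qi] := eqVneq q i; first by subst.
  have [?|qj] := eqVneq q j; first by subst; rewrite eqxx in npq.
  have [?|qk _] := eqVneq q k; first by subst.
  by rewrite ZD0 //; distinct.
have [pE|pk _] := eqVneq p k.
  subst p.
  have [?|qi] := eqVneq q i; first by subst.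
  have [?|qj] := eqVneq q j; first by subst.
  have [?|qk _] := eqVneq q k; first by subst; rewrite eqxx in npq.
  by rewrite Zanti ZD0 ?oppr0 //; distinct.
have [->|qi] := eqVneq q i.
  by rewrite ZB2 ?(Zanti p i) ?ZD0 ?oppr0 //; distinct.
have [->|qj] := eqVneq q j; first by rewrite ZA' //; distinct.
have [->|qk] := eqVneq q k; first by rewrite ZA //; distinct.
by rewrite Zout //; distinct.
Qed.

Lemma Zoutside i j k c w : uniq [:: i; j; k] -> outside i j k c -> c \in w ->
  (2 < size w)%N -> sbr i j k w = 0.
Proof.
move=> U oc cw sw; rewrite (Zperm _ _ _ (perm_to_rem cw)) Zoutside_cons //.
by rewrite size_rem // -ltnS prednK //; apply: leq_ltn_trans sw.
Qed.

(** Jacobi for beta_ab, beta_db, beta_ba, where the first two commute. The letter (d, b) acts on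
    [beta_ab, beta_ba] as on -Z_dab, which motivates the correction term in [hbr]. *)
Lemma YZ_tgt (a b d : I) u : uniq [:: a; b; d] ->
    f (a, b) (b, a) ((d, b) :: u) + sbr d a b ((d, b) :: u) = 0.
Proof.
move=> U'; have := cs_jacobi fP (a, b) (d, b) (b, a) u.
rewrite (cs_target fP) ?(path_Z (i := d)); try by distinct.
rewrite add0r -Zanti (cs_anti fP (b, a)) => /eqP.
rewrite subr_eq0 => /eqP <-; rewrite Zsnd ?addNr //; distinct.
Qed.

Lemma YZ_tgt' (a b d : I) u : uniq [:: a; b; d] ->
    f (a, b) (b, a) ((d, a) :: u) + sbr d a b ((d, a) :: u) = 0.
Proof.
move=> U'; rewrite (cs_anti fP) Zanti -opprD YZ_tgt ?oppr0 //; distinct.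
Qed.

(** Combines Jacobi for beta_ab, beta_ad, beta_ba with the cyclic relation. The right-hand side is
    an obstruction, which [ZK] shows to vanish in higher degree. *)
Lemma YZ_src (a b d : I) u : uniq [:: a; b; d] ->
    f (a, b) (b, a) ((a, d) :: u) + sbr d a b ((a, d) :: u)
  = sbr b a d ((a, b) :: u) + sbr b a d ((d, b) :: u).
Proof.
move=> U'; have := cs_jacobi fP (a, b) (a, d) (b, a) u.
have := @Zcyclic a d b u.
have -> : uniq [:: a; d; b] by distinct.
move=> /(_ isT).
rewrite -/(sbr a b d _) path_Z'; last by distinct.
rewrite (cs_anti fP (b, a)) (Zanti a d) (Zanti d b).
move=> E1 /eqP; rewrite subr_eq0 => /eqP <-.
move/eqP: E1; rewrite -opprD addrC subr_eq0 => /eqP ->.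
by rewrite addrA; congr (_ + _); rewrite addrC.
Qed.

(** By [YZ_src], X_ab + X_db on Z_bad equals X_ad on [beta_ab, beta_ba] + Z_dab, and a further
    letter (d, a) or (d, b) kills the latter by [YZ_tgt]. So one inspects the next letter c: outside
    letters kill, and inside ones can be given that form by antisymmetry, [Zfst] or [Zsnd]. *)
Lemma ZK i j k w : uniq [:: i; j; k] -> (2 < size w)%N ->
  sbr i j k ((j, i) :: w) = - sbr i j k ((k, i) :: w).
Proof.
move=> U.
wlog [c [w' ->]] : w / exists c w', w = c :: w'.
  by case: w => // c w H; apply: H; exists c, w.
move=> /= sw.
have [oc|] := boolP (outside i j k c).
  by rewrite !(Zswap _ _ _ _ c) !Zoutside_cons ?oppr0 //=; exact: ltnW.
have kK (a b d : I) p u : uniq [:: a; b; d] -> p \in [:: a; b] ->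
    sbr b a d ((a, b) :: (d, p) :: u) + sbr b a d ((d, b) :: (d, p) :: u) = 0.
  move=> U'; rewrite -YZ_src // !inE (cs_perm fP _ _ (w' := (d, p) :: (a, d) :: u)); last first.
    by apply/permP => x /=; lia.
  by rewrite Zswap => /orP [] /eqP ->; rewrite ?YZ_tgt ?YZ_tgt'.

have KE0 (a b d : I) u : sbr b a d ((a, b) :: u) + sbr b a d ((d, b) :: u) = 0 ->
   sbr b a d ((a, b) :: u) = - sbr b a d ((d, b) :: u).
  by move/eqP; rewrite addr_eq0 => /eqP.
case: c => p q; rewrite /outside /= negb_or !negbK !inE => /andP [pP qP].
have [->|npq] := eqVneq p q.
  by rewrite !(Zswap _ _ _ _ (q, q)) /sbr !(cs_diag_cons fP) oppr0.
have Hk r : r \in [:: j; i] ->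
    sbr i j k ((j, i) :: (k, r) :: w') = - sbr i j k ((k, i) :: (k, r) :: w').
  by move=> rP; apply: KE0; apply: kK => //; distinct.
have Hj r : r \in [:: k; i] ->
    sbr i j k ((j, i) :: (j, r) :: w') = - sbr i j k ((k, i) :: (j, r) :: w').
  by move=> rP; rewrite !(Zanti i j k) opprK KE0 ?opprK //; apply: kK => //; distinct.
have [pE|pk] := eqVneq p k; first subst p.
  by apply: Hk; move: qP; rewrite !inE [q == k]eq_sym (negPf npq) orbF orbC.
have [pE|pj] := eqVneq p j; first subst p.
  by apply: Hj; move: qP; rewrite !inE [q == j]eq_sym (negPf npq) /= orbC.
have pE : p = i by move: pP; rewrite (negPf pk) (negPf pj) !orbF => /eqP.
subst p; rewrite !(Zswap _ _ _ _ (i, q)).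
move: qP; rewrite [q == i]eq_sym (negPf npq) /= => /orP [] /eqP ->.
  rewrite -[LHS]opprK -[in RHS](opprK (sbr _ _ _ _)) -!Zfst //.
  by rewrite !(Zswap _ _ _ (k, j)) Hk ?inE ?eqxx.
rewrite -[LHS]opprK -[in RHS](opprK (sbr _ _ _ _)) -!Zsnd //.
by rewrite !(Zswap _ _ _ (j, k)) Hj ?inE ?eqxx.
Qed.

(** The summand of index m cancels the effect on [beta_ij, beta_ji] of the letters that involve
    m. *)
Definition hbr i j w :=
  f (i, j) (j, i) w + \sum_(m | m \notin [:: i; j]) sbr m i j w.

Lemma Hanti i j w : hbr i j w = - hbr j i w.
Proof.
rewrite /hbr opprD -(cs_anti fP) -sumrN; congr (_ + _).
apply: eq_big => [m|m _]; last by rewrite -Zanti.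
by rewrite !inE orbC.
Qed.

Lemma Hperm i j w w' : perm_eq w w' -> hbr i j w = hbr i j w'.
Proof.
move=> ww; rewrite /hbr (cs_perm fP _ _ ww); congr (_ + _).
by apply: eq_bigr => m _; apply: Zperm.
Qed.

Lemma Hsum1 i j k c w : uniq [:: i; j; k] -> (c.1 == k) || (c.2 == k) ->
  (1 < size w)%N -> hbr i j (c :: w) = f (i, j) (j, i) (c :: w) + sbr k i j (c :: w).
Proof.
move=> U cE sw; rewrite /hbr (bigD1 k) /=; last by distinct.
rewrite big1 ?addr0 // => m /andP []; rewrite !inE !negb_or => /andP [mi mj] mk.
rewrite Zoutside_cons //; first by distinct.
by rewrite /outside !inE; case/orP: cE => /eqP ->; apply/orP; [left|right]; distinct.
Qed.

(** A letter joining i or j to a third index k sees only the summand of k ([Hsum1]), which cancels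
    against the main bracket by [YZ_tgt], [YZ_tgt'], or [YZ_src] with [ZK]. A letter avoiding both i
    and j kills every term separately. *)
Lemma H0 i j c w : i != j -> c \notin [:: (i, j); (j, i)] -> (2 < size w)%N ->
  hbr i j (c :: w) = 0.
Proof.
move=> nij + sw.
have sw' : (1 < size w)%N by exact: ltnW.
have src (a b k : I) : uniq [:: a; b; k] -> hbr a b ((a, k) :: w) = 0.
  move=> U; rewrite (Hsum1 (k := k)) ?eqxx ?orbT // YZ_src //.
  by rewrite ZK ?addNr //; distinct.
case: c => p q; rewrite !inE !xpair_eqE negb_or => cP.
have [->|npq] := eqVneq p q.
  rewrite /hbr (cs_diag_cons fP) add0r big1 // => m _; exact: (cs_diag_cons fP).
have [pE|pi] := eqVneq p i; first subst p.
  by apply: src; move: cP; rewrite eqxx => /andP [? _]; distinct.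
have [pE|pj] := eqVneq p j; first subst p.
  rewrite Hanti src ?oppr0 //.
  by move: cP; rewrite eqxx => /andP [_ ?]; distinct.
have [->|qi] := eqVneq q i.
  by rewrite (Hsum1 (k := p)) ?eqxx // ?YZ_tgt' //; distinct.
have [->|qj] := eqVneq q j.
  by rewrite (Hsum1 (k := p)) ?eqxx // ?YZ_tgt //; distinct.
rewrite /hbr big1 => [|m]; last first.
  rewrite !inE negb_or => /andP [mi mj]; apply: Zoutside_cons => //; first by distinct.
  rewrite /outside /= !inE !negb_or pi pj qi qj /= !andbT -negb_and.
  by apply: contraNN npq => /andP [/eqP -> /eqP ->].
have := cs_jacobi fP (i, j) (j, i) (p, q) w.
by rewrite addr0 (cs_disj fP (i := j)) ?(cs_disj fP (i := p)) ?addr0 //; distinct.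
Qed.

(** [Zfst], [Zsnd] and [ZK] in one form: up to sign only the target of an inside letter matters, so
    three variables remain. *)
Lemma Zflip i j k (a b t : I) w : uniq [:: i; j; k] ->
  perm_eq [:: a; b; t] [:: i; j; k] -> (2 < size w)%N ->
  sbr i j k ((a, t) :: w) = - sbr i j k ((b, t) :: w).
Proof.
move=> U pm sw; have := perm_uniq pm; rewrite U => U'.
have /perm_mem mm := pm.
move: (mm a) (mm b) (mm t); rewrite !inE !eqxx ?orbT /= => /esym aP /esym bP /esym tP.
move: U'; rewrite /= !inE !negb_or !andbT => /andP [/andP [ab aT] bt].
case/or3P: tP => /eqP ?; subst t; case/or3P: aP => /eqP ?; subst a;
  case/or3P: bP => /eqP ?; subst b; rewrite ?eqxx // in ab aT bt *.
- by rewrite ZK.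
- by rewrite ZK ?opprK.
- by rewrite Zfst ?opprK.
- by rewrite Zfst.
- by rewrite Zsnd ?opprK.
- by rewrite Zsnd.
Qed.

(** * A spanning family in degree d > 3 *)

Section Span.
Variables (W : V -> Prop) (d : nat).
Hypotheses (W0 : W 0) (WD : forall u v, W u -> W v -> W (u + v))
  (WN : forall u, W u -> W (- u)) (d_gt : (3 < d)%N).

Definition mono i j k (p q r : nat) := nseq p (k, i) ++ nseq q (i, j) ++ nseq r (j, k).

(** By [Zflip] the letters (k, i), (i, j), (j, k), one for each target, suffice. [Zcyclic] then
    trades the letter (j, k) on the third bracket for the other two brackets, so that bracket needs
    only monomials in two letters. *)
Lemma span_triple i j k : uniq [:: i; j; k] ->
  (forall (p q r : nat), (p + q + r = d)%N -> W (f (i, j) (j, k) (mono i j k p q r))) ->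
  (forall (p q r : nat), (p + q + r = d)%N -> W (f (j, k) (k, i) (mono i j k p q r))) ->
  (forall (p q : nat), (p + q = d)%N -> W (f (k, i) (i, j) (mono i j k p q 0))) ->
  forall w, size w = d ->
  [/\ W (sbr i j k w), W (sbr j k i w) & W (sbr k i j w)].
Proof.
move=> U G1 G2 G3.
have U2 : uniq [:: j; k; i] by distinct.
have U3 : uniq [:: k; i; j] by distinct.
pose P w := [/\ W (sbr i j k w), W (sbr j k i w) & W (sbr k i j w)].
have Pperm w w' : perm_eq w w' -> P w -> P w'.
  by move=> ww; rewrite /P -!(Zperm _ _ _ ww).
have Pflip (a b t : I) w : perm_eq [:: a; b; t] [:: i; j; k] -> (2 < size w)%N ->
    P ((b, t) :: w) -> P ((a, t) :: w).
  move=> pm sw [? ? ?]; split; rewrite (Zflip (b := b)) //; try exact: WN.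
    by rewrite (perm_trans pm) // perm_sym (perm_rot 1 [:: i; j; k]).
  by rewrite (perm_trans pm) // perm_sym (perm_rot 2 [:: i; j; k]).
have Pout c w : outside i j k c -> (1 < size w)%N -> P (c :: w).
  move=> oc sw; rewrite /P !Zoutside_cons //; move: oc; rewrite /outside !inE; do !case: (_ == _) => //.
pose L := [:: (k, i); (i, j); (j, k)].
have Pcanon w : size w = d -> all (mem L) w -> P w.
  have uL : uniq L by rewrite /= !inE !xpair_eqE; move: U; rewrite /= !inE !negb_or; do !case: (_ =P _) => //= ?; subst.
  have pre w' : size w' = d -> all (mem L) w' ->
      W (sbr i j k w') /\ W (sbr j k i w').
    move=> sw' aw'; have := perm_flatten_nseq uL aw'.
    rewrite /= cats0 -/(mono i j k _ _ _) => pm.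
    have sz := perm_size pm; rewrite !size_cat !size_nseq sw' addnA in sz.
    rewrite !(Zperm _ _ _ pm) -[sbr i j k _]opprK -[sbr j k i _]opprK -!path_Z //.
    by split; apply: WN; [apply: G1|apply: G2].
  move=> sw aw; have [? ?] := pre w sw aw; split=> //.
  have [jkw|jkw] := boolP ((j, k) \in w).
    rewrite (Zperm _ _ _ (perm_to_rem jkw)).
    set w' := rem _ _; have Lw' : all (mem L) w'.
      by apply/allP => x /mem_rem; apply: (allP aw).
    have sw' : (size w').+1 = d by rewrite -sw (perm_size (perm_to_rem jkw)).
    have /eqP := Zcyclic w' U; rewrite addrC addr_eq0 => /eqP ->.
    apply: WN; apply: WD.
      by case: (pre ((k, i) :: w')) => //=; rewrite Lw' !inE eqxx.
    by case: (pre ((i, j) :: w')) => //=; rewrite Lw' !inE eqxx !orbT.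
  have pm := perm_flatten_nseq uL aw.
  rewrite /= (count_memPn jkw) cats0 -/(mono i j k _ _ 0) in pm.
  have sz := perm_size pm; rewrite !size_cat !size_nseq sw addn0 in sz.
  by rewrite (Zperm _ _ _ pm) -[sbr k i j _]opprK -path_Z //; apply: WN; apply: G3.
(* [w2] holds the letters already replaced by canonical ones; the induction moves letters from [w1]
   to it. *)
suff main w1 w2 : all (mem L) w2 -> size (w1 ++ w2) = d -> P (w1 ++ w2).
  by move=> w sw; have := main w [::]; rewrite cats0; apply.
elim: w1 w2 => [|[a t] w1 IH] w2 Lw2 /= sz; first exact: Pcanon.
have sz' : (2 < size (w1 ++ w2))%N by rewrite -ltnS sz.
have canon c : c \in L -> P (c :: (w1 ++ w2)).
  move=> cL; apply: (Pperm (w1 ++ (c :: w2))); first by rewrite -cat1s perm_catCA.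
  by apply: IH; rewrite /= ?cL // size_cat /= addnS -size_cat.
have [|] := boolP (outside i j k (a, t)); first by move=> oc; apply: Pout => //; exact: ltnW.
rewrite /outside /= negb_or !negbK !inE => /andP [].
have pm1 : perm_eq [:: j; k; i] [:: i; j; k] by rewrite (perm_rot 1 [:: i; j; k]).
have pm2 : perm_eq [:: k; i; j] [:: i; j; k] by rewrite (perm_rot 2 [:: i; j; k]).
have diag s : P ((s, s) :: (w1 ++ w2)) by rewrite /P /sbr !(cs_diag_cons fP).
case/or3P => /eqP -> /or3P [] /eqP ->; try exact: diag; try by apply: canon; rewrite !inE eqxx ?orbT.
- by apply: (Pflip _ j) => //; apply: canon; rewrite !inE eqxx ?orbT.
- by apply: (Pflip _ k) => //; apply: canon; rewrite !inE eqxx ?orbT.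
- by apply: (Pflip _ i) => //; apply: canon; rewrite !inE eqxx ?orbT.
Qed.

Lemma span_pair i j : i != j ->
  (forall (p q : nat), (p + q = d)%N -> W (hbr i j (nseq p (i, j) ++ nseq q (j, i)))) ->
  forall w, size w = d -> W (hbr i j w).
Proof.
move=> nij G w sw; set L := [:: (i, j); (j, i)].
have [Lw|/allPn [c cw cL]] := boolP (all (mem L) w).
  have uL : uniq L by rewrite /= !inE xpair_eqE (negPf nij).
  have := perm_flatten_nseq uL Lw; rewrite /= cats0 => pm.
  have sz := perm_size pm; rewrite size_cat !size_nseq sw in sz.
  by rewrite (Hperm _ _ pm); apply: G.
rewrite (Hperm _ _ (perm_to_rem cw)) H0 // -ltnS.
by rewrite -[(size _).+1]/(size (c :: _)) -(perm_size (perm_to_rem cw)) sw.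
Qed.

(** Two letters either commute, or have bracket a signed Z, or are opposite; in the last case their
    bracket is H minus a sum of Z's. *)
Lemma span_all : (forall i j w, i != j -> size w = d -> W (hbr i j w)) ->
  (forall i j k w, uniq [:: i; j; k] -> size w = d -> W (sbr i j k w)) ->
  forall a b w, size w = d -> W (f a b w).
Proof.
move=> HW ZW [i j] [k l] w sw.
have [<-|nij] := eqVneq i j; first by rewrite (cs_diag fP).
have [<-|nkl] := eqVneq k l; first by rewrite (cs_anti fP) (cs_diag fP) oppr0.
have [ki|ki] := eqVneq k i; first subst k.
  have [->|lj] := eqVneq l j; first by rewrite (cs_alt fP).
  by apply: ZW => //; distinct.
have [kj|kj] := eqVneq k j; first subst k.
  have [->|li] := eqVneq l i; last first.
    by rewrite path_Z; [apply: WN; apply: ZW => //; distinct | distinct].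
  have -> : f (i, j) (j, i) w = hbr i j w - \sum_(m | m \notin [:: i; j]) sbr m i j w.
    by rewrite /hbr addrK.
  apply: WD; [exact: HW|apply: WN].
  apply: (big_ind W) => // m; rewrite !inE negb_or => /andP [? ?].
  by apply: ZW => //; distinct.
have [->|li] := eqVneq l i.
  by rewrite path_Z'; [apply: ZW => //; distinct | distinct].
have [->|lj] := eqVneq l j; first by rewrite (cs_target fP) //; distinct.
by rewrite (cs_disj fP) //; distinct.
Qed.
End Span.
End ChenSystem.

Local Close Scope ring_scope.

(** * Metabelian groups *)

Local Open Scope group_scope.

Section Metabelian.
Variable G : groupType.

Definition metabelian := forall a b c d : G, commute (comg a b) (comg c d).

(** Products of commutators suffice, because the inverse of a commutator is a commutator
    ([comgV]). *)
Inductive derived : G -> Prop :=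
| derived1 : derived 1
| derivedM a b x : derived x -> derived (comg a b * x).

Lemma derived_mul x y : derived x -> derived y -> derived (x * y).
Proof.
by elim=> [|a b z _ IH] dy; rewrite ?mul1g // -mulgA; apply: derivedM; apply: IH.
Qed.

Lemma derived_comg a b : derived (comg a b).
Proof. by rewrite -[comg a b]mulg1; apply: derivedM; exact: derived1. Qed.

Lemma comgV (a b : G) : (comg a b)^-1 = comg b a.
Proof. by rewrite /comg !invgM !invgK !mulgA. Qed.

Lemma derived_inv x : derived x -> derived x^-1.
Proof.
elim=> [|a b z _ IH]; first by rewrite invg1; exact: derived1.
by rewrite invgM comgV; apply: derived_mul => //; exact: derived_comg.
Qed.

Lemma comgJ (g a b : G) :
  g * comg a b * g^-1 = comg (g * a * g^-1) (g * b * g^-1).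
Proof. by rewrite /comg !invgM !invgK !mulgA !mulgVK. Qed.

Lemma derived_conj g x : derived x -> derived (g * x * g^-1).
Proof.
elim=> [|a b z _ IH]; first by rewrite mulg1 mulgV; exact: derived1.
rewrite (_ : _ * _ = comg (g * a * g^-1) (g * b * g^-1) * (g * z * g^-1)).
  exact: derivedM.
by rewrite -comgJ !mulgA mulgVK.
Qed.

(** The derived subgroup, to be written additively. The proof [M] is a parameter because the
    commutative addition depends on it. *)
Record der (M : metabelian) := Der { dval : G; _ : `[< derived dval >] }.

Variable M : metabelian.
Notation D := (der M).
HB.instance Definition _ := [isSub of D for @dval M].
HB.instance Definition _ := [Choice of D by <:].

Lemma dvalP (d : D) : derived (dval d).
Proof. by case: d => x /= /asboolP. Qed.

Definition mkder x (dx : derived x) : D := @Der M x (asboolT dx).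

Lemma derived_commute x y : derived x -> derived y -> commute x y.
Proof.
have comm1 a b z : derived z -> commute (comg a b) z.
  elim=> [|c e t _ IH]; first by rewrite /commute mulg1 mul1g.
  by apply: commuteM; [exact: M|exact: IH].
move=> dx dy; elim: dx => [|a b z _ IH]; first by rewrite /commute mul1g mulg1.
by apply: commute_sym; apply: commuteM; apply: commute_sym; [exact: comm1|].
Qed.

Definition der_add (x y : D) := mkder (derived_mul (dvalP x) (dvalP y)).
Definition der_opp (x : D) := mkder (derived_inv (dvalP x)).

Lemma der_addA : associative der_add.
Proof. by move=> x y z; apply: val_inj => /=; rewrite mulgA. Qed.
Lemma der_addC : commutative der_add.
Proof. by move=> x y; apply: val_inj => /=; exact: derived_commute (dvalP x) (dvalP y). Qed.
Lemma der_add0 : left_id (mkder derived1) der_add.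
Proof. by move=> x; apply: val_inj => /=; rewrite mul1g. Qed.
Lemma der_addN : left_inverse (mkder derived1) der_opp der_add.
Proof. by move=> x; apply: val_inj => /=; rewrite mulVg. Qed.
HB.instance Definition _ :=
  GRing.isZmodule.Build D der_addA der_addC der_add0 der_addN.

Definition act g (d : D) : D := mkder (derived_conj g (dvalP d)).
Definition br a b : D := mkder (derived_comg a b).
(** The operator X_g = g - 1 of the group ring. *)
Definition dact g (d : D) : D := (act g d - d)%R.

Lemma actD g : {morph act g : x y / (x + y)%R}.
Proof. by move=> x y; apply: val_inj => /=; rewrite !mulgA mulgVK. Qed.

Lemma actN g : {morph act g : x / (- x)%R}.
Proof.
move=> x; apply/eqP; rewrite -addr_eq0 -actD addNr.
by apply/eqP/val_inj => /=; rewrite mulg1 mulgV.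
Qed.

Lemma act1 d : act 1 d = d.
Proof. by apply: val_inj => /=; rewrite mul1g invg1 mulg1. Qed.

Lemma actM g h d : act (g * h) d = act g (act h d).
Proof. by apply: val_inj => /=; rewrite invgM !mulgA. Qed.

Lemma act_der (x d : D) : act (dval x) d = d.
Proof.
apply: val_inj => /=.
by rewrite (derived_commute (dvalP x) (dvalP d)) mulgK.
Qed.

(** The elements gh and hg differ by a commutator, which acts trivially on the abelian derived
    subgroup; hence the operators X_g commute. *)
Lemma actC g h d : act g (act h d) = act h (act g d).
Proof.
rewrite -!actM; have -> : g * h = dval (br g h) * (h * g).
  by rewrite /= /comg !mulgA !mulgVK.
by rewrite actM act_der.
Qed.

Lemma actK g d : act g (act g^-1 d) = d.
Proof. by rewrite -actM mulgV act1. Qed.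

Lemma XD g : {morph dact g : x y / (x + y)%R}.
Proof. by move=> x y; rewrite /dact actD opprD addrACA. Qed.

Lemma XN g : {morph dact g : x / (- x)%R}.
Proof. by move=> x; rewrite /dact actN opprD. Qed.

Lemma X0 g : dact g 0%R = 0%R.
Proof.
by apply/eqP; rewrite subr_eq0; apply/eqP/val_inj; rewrite /= mulg1 mulgV.
Qed.

Lemma XC g h d : dact g (dact h d) = dact h (dact g d).
Proof.
rewrite {1 3}/dact ![act _ (dact _ _)]actD !actN actC /dact !opprB.
by rewrite addrACA [RHS]addrACA; congr (_ + _)%R; rewrite addrC.
Qed.

Lemma X1 d : dact 1 d = 0%R.
Proof. by rewrite /dact act1 subrr. Qed.

Lemma XM g h d : dact (g * h) d = (act g (dact h d) + dact g d)%R.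
Proof. by rewrite /dact actM actD actN addrA addrNK. Qed.

Lemma XV g d : dact g^-1 d = (- act g^-1 (dact g d))%R.
Proof. by rewrite {2}/dact actD actN -actM mulVg act1 opprB. Qed.

Lemma br_anti a b : br a b = (- br b a)%R.
Proof. by apply: val_inj => /=; rewrite comgV. Qed.

Lemma br_eq0 a b : commute a b -> br a b = 0%R.
Proof. by move=> ab; apply: val_inj; rewrite /= /comg ab mulgK mulgV. Qed.

Lemma brMl a b c : br (a * b) c = (act a (br b c) + br a c)%R.
Proof. by apply: val_inj; rewrite /= /comg !invgM !mulgA !mulgVK. Qed.

Lemma brVl a c : br a^-1 c = (- act a^-1 (br a c))%R.
Proof.
apply/eqP; rewrite -addr_eq0 addrC -brMl mulVg.
by apply/eqP; apply: br_eq0; rewrite /commute mul1g mulg1.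
Qed.

Lemma br_der (d : D) c : br (dval d) c = (- dact c d)%R.
Proof.
by rewrite opprB; apply: val_inj; rewrite /= /comg !invgM invgK !mulgA.
Qed.

Lemma br_dval u (d : D) : br u (dval d) = dact u d.
Proof. by rewrite br_anti br_der opprK. Qed.

(* Expand [a b, c] and [[a, b] b a, c], the same element, in two ways. *)
Lemma br_jacobi a b c : (dact c (br a b) + dact a (br b c) + dact b (br c a) = 0)%R.
Proof.
have E : br (a * b) c = br (dval (br a b) * (b * a)) c.
  by congr br; rewrite /= /comg !mulgA !mulgVK.
move: E; rewrite brMl (brMl (dval _)) act_der br_der brMl (br_anti a c).
rewrite (br_anti c a) XN /dact -/(dact c _) => E.
have -> : forall x aQ Q bR R : D, (x + (aQ - Q) - (bR - R) = aQ + R - (- x + (bR + Q)))%R.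
  move=> x aQ Q bR R; rewrite !opprD !opprK !addrA.
  by rewrite [LHS](ACl (2*5*1*4*3)).
rewrite !opprK in E; rewrite E; apply/eqP; rewrite subr_eq0.
by rewrite [eqbRHS]addrC.
Qed.

Definition foldX (d : D) (ws : seq G) := foldr dact d ws.

Lemma foldXD ws : {morph foldX^~ ws : x y / (x + y)%R}.
Proof. by elim: ws => //= g ws IH x y; rewrite IH XD. Qed.

Lemma foldXN ws : {morph foldX^~ ws : x / (- x)%R}.
Proof. by elim: ws => //= g ws IH x; rewrite IH XN. Qed.

Lemma foldX0 ws : foldX 0%R ws = 0%R.
Proof. by elim: ws => //= g ws ->; rewrite X0. Qed.

Lemma foldX_X g d ws : foldX (dact g d) ws = dact g (foldX d ws).
Proof. by elim: ws => //= h ws ->; rewrite XC. Qed.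

Lemma foldX_cat d s1 s2 : foldX d (s1 ++ s2) = foldX (foldX d s2) s1.
Proof. exact: foldr_cat. Qed.

Lemma foldX_comm d s1 s2 : foldX (foldX d s2) s1 = foldX (foldX d s1) s2.
Proof. by elim: s1 d => //= g s1 IH d; rewrite IH foldX_X. Qed.

Lemma foldX_perm (E : eqType) (e : E -> G) d (s1 s2 : seq E) :
  perm_eq s1 s2 -> foldX d (map e s1) = foldX d (map e s2).
Proof.
move=> pm; apply: (catCA_perm_subst (F := fun s => foldX d (map e s))) pm => r1 r2 r3.
by rewrite !map_cat !foldX_cat (foldX_comm _ _ (map e r2)).
Qed.

(** A bracket followed by n + 1 operators is a commutator of weight n + 3. *)
Definition nilpotent n :=
  forall a b ws, size ws = n.+1 -> foldX (br a b) ws = 0%R.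

Section Nilpotent.
Variable n : nat.
Hypothesis nilG : nilpotent n.

Lemma foldX_nil (d : D) ws : size ws = n.+1 -> foldX d ws = 0%R.
Proof.
move=> sw; suff main x : derived x -> forall d' : D, dval d' = x -> foldX d' ws = 0%R.
  exact: main (dvalP d) _ erefl.
elim=> {x} [|a b z dz IH] {}d dE.
  by rewrite -[RHS](foldX0 ws); congr (foldX _ ws); exact: val_inj.
rewrite (_ : d = br a b + mkder dz)%R; last exact: val_inj.
by rewrite foldXD nilG // IH // addr0.
Qed.

Lemma foldX_nil_ge (d : D) ws : n < size ws -> foldX d ws = 0%R.
Proof.
move=> sw; rewrite -(cat_take_drop n.+1 ws) foldX_cat foldX_nil //.
exact: size_takel.
Qed.

Section System.
Variables (I : finType) (e : I * I -> G).
Hypotheses (e_diag : forall i, e (i, i) = 1)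
  (e_disj : forall i j k l, uniq [:: i; j; k; l] -> commute (e (i, j)) (e (k, l)))
  (e_target : forall i j k, uniq [:: i; j; k] -> commute (e (i, k)) (e (j, k)))
  (e_path : forall i j k, uniq [:: i; j; k] ->
     commute (e (i, j)) (e (i, k) * e (j, k))).

(* [br a b] times the monomial [w], cut off to monomials of degree [n], where
   all terms of higher commutator weight vanish. *)
Definition chen_fun a b (w : seq (I * I)) : D :=
  if size w == n then foldX (br (e a) (e b)) (map e w) else 0%R.

Lemma chen_funP : chen_system chen_fun.
Proof.
split; rewrite /chen_fun.
- move=> a b w w' ww; rewrite (perm_size ww); case: eqP => // _.
  exact: foldX_perm.
- by move=> a w; rewrite br_eq0 // foldX0; case: eqP.
- move=> a b w; rewrite br_anti foldXN; case: eqP => // _.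
  by rewrite oppr0.
- move=> i b w; rewrite e_diag br_eq0 ?foldX0; first by case: eqP.
  by rewrite /commute mulg1 mul1g.
- by move=> a b i w; rewrite /= e_diag X1; case: eqP.
- move=> a b c w /=; case: eqP => _; last by rewrite !addr0.
  by rewrite -!foldX_X -!foldXD br_jacobi foldX0.
- by move=> i j k l w U; rewrite br_eq0 ?foldX0; [case: eqP|exact: e_disj].
- by move=> i j k w U; rewrite br_eq0 ?foldX0; [case: eqP|exact: e_target].
move=> i j k w U; case: eqP => [sw|_]; last by rewrite addr0.
(* The relator holds only up to a term with one more operator. Since [w] has length n, nilpotency
   removes that term. *)
have E : (br (e (i, j)) (e (i, k)) + br (e (i, j)) (e (j, k)) =
    - dact (e (i, k)) (br (e (i, j)) (e (j, k))))%R.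
  have := br_eq0 (e_path U); rewrite br_anti brMl opprD -actN -!br_anti.
  move=> E; apply/eqP; rewrite -addr_eq0; apply/eqP; rewrite -[RHS]E /dact.
  by rewrite -addrA [(_ + (_ - _))%R]addrCA subrr addr0 addrC.
rewrite -foldXD E foldXN foldX_X -[dact _ _]/(foldX _ (_ :: _)).
by rewrite foldX_nil ?oppr0 //= size_map sw.
Qed.
End System.

(** * The lower central series inside the derived module *)

Section Filtration.
Variables (E : eqType) (g : E -> G).
Hypothesis g_gen : forall x, exists w : word E, x = ev g w.

Definition closed (W : D -> Prop) := [/\ W 0%R, (forall u v, W u -> W v -> W (u + v)%R)
  & forall u, W u -> W (- u)%R].

(* The span of all [br a b] times monomials of degree at least [j] in the
   generators. *)
Definition filt j (d : D) := forall W, closed W ->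
  (forall a b w, j <= size w -> W (foldX (br (g a) (g b)) (map g w))) -> W d.

Lemma filt_closed j : closed (filt j).
Proof.
split=> [W [] //|u v fu fv W Wc Wj|u fu W Wc Wj].
  by have [_ WD _] := Wc; apply: WD; [exact: fu|exact: fv].
by have [_ _ WN] := Wc; apply: WN; exact: fu.
Qed.

Lemma filt0 j : filt j 0%R. Proof. by case: (filt_closed j). Qed.
Lemma filtD j u v : filt j u -> filt j v -> filt j (u + v)%R.
Proof. by case: (filt_closed j) => _ H _; exact: H. Qed.
Lemma filtN j u : filt j u -> filt j (- u)%R.
Proof. by case: (filt_closed j) => _ _ H; exact: H. Qed.

Lemma filt_gen j a b w : j <= size w -> filt j (foldX (br (g a) (g b)) (map g w)).
Proof. by move=> jw W _; apply. Qed.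

Lemma filtW j d : filt j.+1 d -> filt j d.
Proof.
move=> f; apply: f; first exact: filt_closed.
by move=> a b w jw; apply: filt_gen; exact: ltnW.
Qed.

Lemma filt_X j a d : filt j d -> filt j.+1 (dact (g a) d).
Proof.
move=> f; apply: (f (fun d => filt j.+1 (dact (g a) d))).
  split=> [|u v fu fv|u fu]; first by rewrite X0; exact: filt0.
    by rewrite XD; exact: filtD.
  by rewrite XN; exact: filtN.
by move=> b c w jw; apply: (@filt_gen _ b c (a :: w)).
Qed.

Lemma filt_actg j a d : filt j d -> filt j (act (g a) d).
Proof.
move=> f; rewrite -[act _ _](subrK d); apply: filtD => //.
by apply: filtW; exact: filt_X.
Qed.

(* [act h^-1] is the geometric series in [- dact h], a finite sum by nilpotency. *)
Lemma filt_actgV j a d : filt j d -> filt j (act (g a)^-1 d).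
Proof.
set h := g a; pose Y u := (- dact h u)%R.
have iterY m u : exists u', iter m Y u = foldX u' (nseq m h).
  elim: m => [|m [u' uE]] /=; first by exists u.
  by exists (- u')%R; rewrite uE /Y foldXN XN.
suff main m : filt j d -> filt j (act h^-1 d - iter m Y (act h^-1 d))%R.
  move=> /(main n.+1); have [u' ->] := iterY n.+1 (act h^-1 d).
  by rewrite foldX_nil ?size_nseq // subr0.
move=> f; elim: m => [|m IH]; first by rewrite subrr; exact: filt0.
set z := act h^-1 d in IH *.
have -> : (z - iter m.+1 Y z = d + Y (z - iter m Y z))%R.
  have dE : (d - dact h z = z)%R by rewrite /dact -{1}(actK h d) -/z opprB addrC subrK.
  by rewrite /= {1 3}/Y XD XN opprK (opprD (dact h z)) opprK [RHS]addrA dE.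
by rewrite {1}/Y; apply: filtD => //; apply: filtN; apply: filtW; exact: filt_X.
Qed.

Lemma filt_act j x d : filt j d -> filt j (act x d).
Proof.
have [w ->] := g_gen x; move=> f; elim: w => [|[a []] w IH] /=.
- by rewrite act1.
- by rewrite actM; exact: filt_actgV.
by rewrite actM; exact: filt_actg.
Qed.

(** The passage from generators to all elements uses X_gh = g X_h + X_g and X_(g^-1) = -g^-1 X_g. *)
Lemma filt_Xall j x d : filt j d -> filt j.+1 (dact x d).
Proof.
have [w ->] := g_gen x; move=> f; elim: w => [|[a b] w IH] /=.
  by rewrite X1; exact: filt0.
rewrite XM; apply: filtD; first exact: filt_act.
rewrite /ev_letter; case: b => /=; last exact: filt_X.
by rewrite XV; apply: filtN; apply: filt_act; exact: filt_X.
Qed.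

Lemma filt_br x y : filt 0 (br x y).
Proof.
have step (z : G) : (forall a, filt 0 (br (g a) z)) -> forall t, filt 0 (br t z).
  move=> H t; have [w ->] := g_gen t; elim: w => [|[a b] w IH] /=.
    by rewrite br_eq0; [exact: filt0|rewrite /commute mul1g mulg1].
  rewrite brMl; apply: filtD; first exact: filt_act.
  rewrite /ev_letter; case: b => //=.
  by rewrite brVl; apply: filtN; exact: filt_act.
apply: (step) => a; rewrite br_anti; apply: filtN; apply: step => b.
exact: (@filt_gen 0 b a [::]).
Qed.

(** The shift by two is the weight of the innermost bracket; each further commutator applies one
    operator. *)
Lemma ev_lcs j w : lcs j.+2 w -> exists2 d : D, dval d = ev g w & filt j d.
Proof.
have gen_case i (S : word E -> Prop) u :
    (forall u', S u' -> exists2 d : D, dval d = ev g u' & filt i d) ->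
    gen S u -> exists2 d : D, dval d = ev g u & filt i d.
  move=> HS; apply: (ev_gen (P := fun x => exists2 d : D, dval d = x & filt i d)) => //.
  - by exists 0%R => //; exact: filt0.
  - by move=> x [d <- fd]; exists (- d)%R => //; exact: filtN.
  - by move=> x y [d <- fd] [d' <- fd']; exists (d + d')%R => //; exact: filtD.
elim: j w => [|j IH] w; apply: gen_case => w' [u [v [_ [lv ->]]]]; rewrite ev_comm.
  by exists (br (ev g u) (ev g v)) => //; exact: filt_br.
have [d <- fd] := IH v lv.
exists (br (ev g u) (dval d)) => //.
by rewrite br_dval; exact: filt_Xall.
Qed.
End Filtration.
End Nilpotent.
End Metabelian.

Local Close Scope group_scope.

(** * Counting and enumerating the spanning family *)

Section ChenIndex.
Variables n d : nat.

Definition incr_tuple m := {t : m.-tuple 'I_n | sorted ltn (map val t)}.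
(** Two of the exponents of a monomial of degree d in three variables; the third is d - p - q. *)
Definition tri := {pq : 'I_d.+1 * 'I_d.+1 | pq.1 + pq.2 <= d}.
Definition pair_index := (incr_tuple 2 * 'I_d.+1)%type.
Definition triple_index := (incr_tuple 3 * (tri + tri + 'I_d.+1))%type.
Definition chen_index := (pair_index + triple_index)%type.

Lemma card_incr_tuple m : #|{: incr_tuple m}| = 'C(n, m).
Proof. by rewrite card_sig -card_ltn_sorted_tuples cardsE. Qed.

Lemma card_tri : #|{: tri}| = 'C(d.+2, 2).
Proof.
rewrite card_sig -sum1_card (eq_bigl (fun pq : 'I_d.+1 * 'I_d.+1 => true && (pq.1 + pq.2 <= d))) //.
rewrite -(pair_big_dep xpredT (fun p q : 'I_d.+1 => p + q <= d) (fun _ _ => 1)) /=.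
rewrite -bin2_sum big_mkord big_ord_recl add0n (reindex_inj rev_ord_inj) /=.
apply: eq_bigr => p _.
rewrite (eq_bigl (fun q : 'I_d.+1 => q < p.+1)); last first.
  by move=> q; have := ltn_ord p; have := ltn_ord q; rewrite /=; lia.
by rewrite -(big_ord_widen _ (fun _ => 1)) ?sum_nat_const ?card_ord ?muln1.
Qed.

(** Each triple contributes 2 C(d+2, 2) + (d + 1) = (d + 1)(d + 3), which is k^2 - 1 for k = d +
    2. *)
Lemma card_chen_index :
  #|{: chen_index}| = d.+1 * 'C(n, 2) + d.+1 * d.+3 * 'C(n, 3).
Proof.
rewrite card_sum !card_prod !card_sum !card_incr_tuple card_tri !card_ord.
have := bin_ffact d.+2 2; rewrite ffactnS ffactn1 (_ : 2`! = 2) //= => E.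
rewrite (_ : 'C(d.+2, 2) + 'C(d.+2, 2) + d.+1 = d.+1 * d.+3); first by rewrite mulnC; lia.
by rewrite addnn -muln2 E; lia.
Qed.

Section Basis.
Variables (V : zmodType) (f : 'I_n * 'I_n -> 'I_n * 'I_n -> seq ('I_n * 'I_n) -> V).

Definition tri1 (t : tri) : nat := (val t).1.
Definition tri2 (t : tri) : nat := (val t).2.

Definition chen_basis (x : chen_index) : V :=
  match x with
  | inl (t, p) =>
      let i := tnth (val t) (inord 0) in let j := tnth (val t) (inord 1) in
      hbr f i j (nseq p (i, j) ++ nseq (d - p) (j, i))
  | inr (t, y) =>
      let i := tnth (val t) (inord 0) in let j := tnth (val t) (inord 1) in
      let k := tnth (val t) (inord 2) in
      match y with
      | inl (inl pq) => f (i, j) (j, k)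
          (mono i j k (tri1 pq) (tri2 pq) (d - tri1 pq - tri2 pq))
      | inl (inr pq) => f (j, k) (k, i)
          (mono i j k (tri1 pq) (tri2 pq) (d - tri1 pq - tri2 pq))
      | inr p => f (k, i) (i, j) (mono i j k p (d - p) 0)
      end
  end.

Definition span_int (T : finType) (g : T -> V) (v : V) :=
  exists m : T -> int, v = (\sum_t g t *~ m t)%R.

Section SpanInt.
Variables (T : finType) (g : T -> V).

Lemma span_int0 : span_int g 0%R.
Proof. by exists (fun _ => 0%R); rewrite big1 // => t _; rewrite mulr0z. Qed.

Lemma span_intD u v : span_int g u -> span_int g v -> span_int g (u + v)%R.
Proof.
move=> [m ->] [m' ->]; exists (fun t => (m t + m' t)%R).
by rewrite -big_split; apply: eq_bigr => t _; rewrite mulrzDr.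
Qed.

Lemma span_intN u : span_int g u -> span_int g (- u)%R.
Proof.
move=> [m ->]; exists (fun t => (- m t)%R).
by rewrite -sumrN; apply: eq_bigr => t _; rewrite mulrNz.
Qed.

Lemma span_int_gen t : span_int g (g t).
Proof.
exists (fun s => Posz (s == t)); rewrite (bigD1 t) //= eqxx mulr1z big1 ?addr0 //.
by move=> s /negPf ->; rewrite mulr0z.
Qed.
End SpanInt.

Hypotheses (fP : chen_system f) (d_gt : 3 < d).
Local Notation W := (span_int chen_basis).

Let W0 : W 0%R := @span_int0 _ chen_basis.
Let WD := @span_intD _ chen_basis.
Let WN := @span_intN _ chen_basis.

(** The basis uses increasing triples. [span_triple] covers their cyclic rotations, and antisymmetry
    covers the other three orders. *)
Lemma span_Z (i j k : 'I_n) w : uniq [:: i; j; k] -> size w = d -> W (sbr f i j k w).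
Proof.
have sorted3 (a b c : 'I_n) w' : a < b -> b < c -> size w' = d ->
    [/\ W (sbr f a b c w'), W (sbr f b c a w') & W (sbr f c a b w')].
  move=> ab bc; have st : sorted ltn (map val [tuple a; b; c]) by rewrite /= ab bc.
  pose t : incr_tuple 3 := exist (fun t => sorted ltn (map val (tval t))) [tuple a; b; c] st.
  have ta : tnth (val t) (inord 0) = a by rewrite (tnth_nth a) inordK.
  have tb : tnth (val t) (inord 1) = b by rewrite (tnth_nth a) inordK.
  have tc : tnth (val t) (inord 2) = c by rewrite (tnth_nth a) inordK.
  apply: (span_triple fP W0 WD WN d_gt).
  - by rewrite /= !inE !negb_or !neq_ltn ab bc (ltn_trans ab bc).
  - move=> p q r E; have lp : p < d.+1 by lia.
    have lq : q < d.+1 by lia.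
    have pq : p + q <= d by lia.
    pose x : tri := exist (fun pq : 'I_d.+1 * 'I_d.+1 => pq.1 + pq.2 <= d) (Ordinal lp, Ordinal lq) pq.
    have := @span_int_gen _ chen_basis (inr (t, inl (inl x))).
    by rewrite /chen_basis ta tb tc (_ : d - _ - _ = r)%N // /tri1 /tri2 /=; lia.
  - move=> p q r E; have lp : p < d.+1 by lia.
    have lq : q < d.+1 by lia.
    have pq : p + q <= d by lia.
    pose x : tri := exist (fun pq : 'I_d.+1 * 'I_d.+1 => pq.1 + pq.2 <= d) (Ordinal lp, Ordinal lq) pq.
    have := @span_int_gen _ chen_basis (inr (t, inl (inr x))).
    by rewrite /chen_basis ta tb tc (_ : d - _ - _ = r)%N // /tri1 /tri2 /=; lia.
  move=> p q E; have lp : p < d.+1 by lia.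
  have := @span_int_gen _ chen_basis (inr (t, inr (Ordinal lp))).
  by rewrite /chen_basis ta tb tc (_ : d - _ = q)%N //=; lia.
rewrite /= !inE negb_or andbT => /andP [/andP [nij nik] njk] sw.
have ZN a b c : W (sbr f a c b w) -> W (sbr f a b c w) by rewrite (Zanti fP a b c) => /WN.
case: (ltngtP i j) nij => [ij _|ji _|/val_inj ->]; last by rewrite eqxx.
  case: (ltngtP j k) njk => [jk _|kj _|/val_inj ->]; last by rewrite eqxx.
    by case: (sorted3 i j k w).
  case: (ltngtP i k) nik => [ik _|ki _|/val_inj ->]; last by rewrite eqxx.
    by apply: ZN; case: (sorted3 i k j w).
  by case: (sorted3 k i j w).
case: (ltngtP j k) njk => [jk _|kj _|/val_inj ->]; last by rewrite eqxx.
  case: (ltngtP i k) nik => [ik _|ki _|/val_inj ->]; last by rewrite eqxx.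
    by apply: ZN; case: (sorted3 j i k w).
  by case: (sorted3 j k i w).
by apply: ZN; case: (sorted3 k j i w).
Qed.

Lemma span_H (i j : 'I_n) w : i != j -> size w = d -> W (hbr f i j w).
Proof.
have sorted2 (a b : 'I_n) w' : a < b -> size w' = d -> W (hbr f a b w').
  move=> ab; have st : sorted ltn (map val [tuple a; b]) by rewrite /= ab.
  pose t : incr_tuple 2 := exist (fun t => sorted ltn (map val (tval t))) [tuple a; b] st.
  have ta : tnth (val t) (inord 0) = a by rewrite (tnth_nth a) inordK.
  have tb : tnth (val t) (inord 1) = b by rewrite (tnth_nth a) inordK.
  apply: (span_pair fP W0 d_gt); first by rewrite neq_ltn ab.
  move=> p q E; have lp : p < d.+1 by lia.
  have := @span_int_gen _ chen_basis (inl (t, Ordinal lp)).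
  by rewrite /chen_basis ta tb (_ : d - _ = q)%N //=; lia.
move=> nij sw; case: (ltngtP i j) nij => [ij _|ji _|/val_inj ->]; last by rewrite eqxx.
  exact: sorted2.
by rewrite (Hanti fP); apply: WN; exact: sorted2.
Qed.

Lemma span_chen a b w : size w = d -> W (f a b w).
Proof.
move=> sw; apply: (span_all fP W0 WD WN) sw => [i j w' nij sw'|i j k w' U sw'].
  exact: span_H.
exact: span_Z.
Qed.
End Basis.
End ChenIndex.

(** More rows than columns force an integer relation among the rows, read off from the Smith normal
    form. *)
Lemma int_left_kernel r (M : 'M[int]_(r.+1, r)) :
  exists2 c : 'I_r.+1 -> int, (exists i, c i != 0%R) &
    forall t, (\sum_i c i * M i t = 0)%R.
Proof.
have [L uL [R uR [dd _ E]]] := int_Smith_normal_form M.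
(* Multiplying by [M] gives the last row of the diagonal factor times [R]; that row is zero since
   there are only r columns. *)
pose c := row ord_max (invmx L).
exists (fun i => c ord0 i).
  apply/existsP; case: (boolP [exists i, c ord0 i != 0%R]) => // /existsPn z.
  have : (c *m L)%R = delta_mx 0%R ord_max by rewrite -row_mul mulVmx // rowE mulmx1.
  rewrite (_ : c = 0%R) ?mul0mx; last first.
    by apply/rowP => i; rewrite [RHS]mxE; apply/eqP; exact: (negbNE (z i)).
  by move=> /matrixP /(_ 0%R ord_max); rewrite !mxE !eqxx.
move=> t; have : (c *m M = 0)%R.
  rewrite E /c -row_mul !mulmxA mulVmx // mul1mx row_mul.
  apply/rowP => j; rewrite !mxE big1 // => s _; rewrite !mxE.
  by rewrite (gtn_eqF (ltn_ord s)) mulr0n mul0r.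
by move=> /rowP /(_ t); rewrite !mxE.
Qed.

(** * The upper bound *)

Section EvPowers.
Variables (X : eqType) (G : groupType) (g : X -> G) (V : zmodType) (phi : V -> G).
Hypotheses (phi0 : phi 0%R = 1%g) (phiD : forall a b, phi (a + b)%R = (phi a * phi b)%g).

Lemma phiN a : phi (- a)%R = ((phi a)^-1)%g.
Proof. by apply/esym/mulg1_eq; rewrite -phiD subrr. Qed.

Lemma ev_powz (u : word X) v c : ev g u = phi v -> ev g (powz u c) = phi (v *~ c)%R.
Proof.
have iterE w x m : ev g w = phi x -> ev g (iter m (mul w) (one X)) = phi (x *+ m)%R.
  move=> E; elim: m => [|m IH]; first by rewrite mulr0n phi0.
  by rewrite iterS ev_mul IH E -phiD mulrS.
case: c => m E; first exact: iterE.
have Ei : ev g (inv u) = phi (- v)%R by rewrite ev_inv E phiN.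
by rewrite [LHS](iterE _ _ m.+1 Ei); congr phi; rewrite NegzE mulrNz mulNrn.
Qed.

Lemma ev_prodz (xs : seq (word X)) (cs : seq int) (v : word X -> V) :
  (forall x, x \in xs -> ev g x = phi (v x)) ->
  ev g (prodz xs cs) = phi (\sum_(p <- zip xs cs) v p.1 *~ p.2)%R.
Proof.
elim: xs cs => [|x xs IH] [|c cs] H; try by rewrite big_nil phi0.
have -> : prodz (x :: xs) (c :: cs) = mul (powz x c) (prodz xs cs) by [].
rewrite big_cons ev_mul phiD (ev_powz c (H x (mem_head _ _))) IH //.
by move=> y ys; apply: H; rewrite inE ys orbT.
Qed.
End EvPowers.

Lemma FG_prodz (X : eqType) (xs : seq (word X)) cs : FG (prodz xs cs).
Proof. by case: xs => [|x xs]; case: cs => [|c cs] //; exact: FG_mul. Qed.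

Lemma zip_sum (X : eqType) (V : zmodType) (x0 : X) (xs : seq X) (cs : seq int) (v : X -> V) r :
  size xs = r -> size cs = r ->
  (\sum_(p <- zip xs cs) v p.1 *~ p.2 = \sum_(i < r) v (nth x0 xs i) *~ nth 0 cs i)%R.
Proof.
move=> sx sc; rewrite (big_nth (x0, 0%R)) size_zip sx sc minnn big_mkord.
by apply: eq_bigr => i _; rewrite nth_zip ?sx ?sc.
Qed.

Section Upper.
Variable n : nat.
Notation E := (PSgen n).
Notation R := (@McCool_rel n).

Lemma FG_McCool w : R w -> FG w.
Proof.
by move=> [[a [b [_ ->]]]|[[a [b [_ [_ ->]]]]|[a [b [c [_ [_ [_ [_ ->]]]]]]]]]; exact: FG_comm.
Qed.

Lemma chen_rel k w : R w -> chen_lcs_pre R k w.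
Proof.
move=> Rw; apply: gen_S; right; apply: gen_S; left; apply: gen_S.
exists (one E), w; do !split=> //.
by rewrite /mul /inv /= cats0 !FG_McCool // FG_McCool.
Qed.

(** Chosen so that [gen (chen_gens k)] unfolds to [chen_lcs_pre R k]. *)
Definition chen_gens k (w : word E) := lcs k w \/ second_derived_pre R w.

Definition mkgen (i j : 'I_n) (nij : i != j) : E :=
  exist (fun p : 'I_n * 'I_n => p.1 != p.2) (i, j) nij.

Section Letters.
Variables (G : groupType) (g : E -> G).
Hypothesis gR : forall w, R w -> ev g w = 1%g.

(** The default 1 on pairs (i, i) lets all of ['I_n * 'I_n] serve as letters, as in
    [chen_system]. *)
Definition letter_of (p : 'I_n * 'I_n) : G := if insub p is Some a then g a else 1%g.

Lemma letter_val (a : E) : letter_of (val a) = g a.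
Proof. by rewrite /letter_of valK. Qed.

Lemma letterE i j (nij : i != j) : letter_of (i, j) = g (mkgen nij).
Proof. by rewrite -letter_val. Qed.

Lemma comg_commute (x y : G) : comg x y = 1%g -> commute x y.
Proof.
by move=> E; rewrite /commute -[RHS]mul1g -E /comg !mulgA !mulgVK.
Qed.

Hypothesis g_surj : forall x, exists w, FG w /\ x = ev g w.

Lemma metabelian_quotient :
  (forall w, second_derived_pre R w -> ev g w = 1%g) -> metabelian G.
Proof.
move=> g2 a b c d; apply: comg_commute.
have [u [Fu ->]] := g_surj a; have [v [Fv ->]] := g_surj b.
have [u' [Fu' ->]] := g_surj c; have [v' [Fv' ->]] := g_surj d.
rewrite -!ev_comm; apply: g2; apply: gen_S; right; apply: gen_S.
exists (comm u v), (comm u' v'); do !split=> //; apply: gen_S.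
  by exists u, v.
by exists u', v'.
Qed.

Lemma nilpotent_quotient (M : metabelian G) d :
  (forall w, lcs d.+3 w -> ev g w = 1%g) -> nilpotent M d.
Proof.
move=> gL a b ws sw.
have [u [Fu ->]] := g_surj a; have [v [Fv ->]] := g_surj b.
suff [z lz zE] : exists2 z, lcs (size ws).+2 z
    & ev g z = dval (foldX (br M (ev g u) (ev g v)) ws).
  by apply: val_inj; rewrite -[LHS]zE gL // -sw.
elim: ws {sw} => [|x ws [z lz zE]].
  by exists (comm u v); [apply: gen_S; exists u, v|rewrite ev_comm].
have [y [Fy ->]] := g_surj x; exists (comm y z).
  by apply: gen_S; exists y, z.
by rewrite ev_comm zE; exact: (congr1 (@dval G M) (br_dval (ev g y) _)).
Qed.

Lemma letter_diag i : letter_of (i, i) = 1%g.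
Proof. by rewrite /letter_of insubF //= eqxx. Qed.

Lemma ev_rel_commute (a b : E) : R (comm (gen1 a) (gen1 b)) -> commute (g a) (g b).
Proof.
by move=> /gR; rewrite ev_comm !ev_gen1 => /comg_commute.
Qed.

Lemma letter_disj i j k l : uniq [:: i; j; k; l] ->
  commute (letter_of (i, j)) (letter_of (k, l)).
Proof.
move=> U; have nij : i != j by distinct.
have nkl : k != l by distinct.
by rewrite (letterE nij) (letterE nkl); apply: ev_rel_commute; left;
  exists (mkgen nij), (mkgen nkl).
Qed.

Lemma letter_target i j k : uniq [:: i; j; k] ->
  commute (letter_of (i, k)) (letter_of (j, k)).
Proof.
move=> U; have nik : i != k by distinct.
have njk : j != k by distinct.
rewrite (letterE nik) (letterE njk); apply: ev_rel_commute; right; left.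
by exists (mkgen nik), (mkgen njk); do !split; distinct.
Qed.

Lemma letter_path i j k : uniq [:: i; j; k] ->
  commute (letter_of (i, j)) (letter_of (i, k) * letter_of (j, k)).
Proof.
move=> U; have nij : i != j by distinct.
have nik : i != k by distinct.
have njk : j != k by distinct.
rewrite (letterE nij) (letterE nik) (letterE njk); apply: comg_commute.
rewrite -(ev_gen1 g (mkgen nij)) -(ev_gen1 g (mkgen nik)) -(ev_gen1 g (mkgen njk)) -ev_mul -ev_comm; apply: gR; right; right.
by exists (mkgen nij), (mkgen nik), (mkgen njk).
Qed.
End Letters.

(** In the quotient by [chen_lcs_pre R d.+3], all the given words lie in the integer span of
    [chen_basis], which has one element fewer than there are words. An integer relation between them
    therefore exists. *)
Lemma chen_upper d (xs : seq (word E)) : 3 < d ->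
  size xs = #|{: chen_index n d}|.+1 ->
  (forall x, x \in xs -> chen_lcs_pre R d.+2 x) ->
  ~ indep_mod (chen_lcs_pre R d.+3) xs.
Proof.
move=> d_gt sxs xsA ind.
have [||Q [g [gK g_surj]]] := @gen_quotient E (chen_gens d.+3).
- by move=> w [/FG_lcs|/FG_second].
- move=> h w Fh [lw|sw]; first by left; exact: conj_closed_lcs.
  by right; exact: conj_closed_second.
have gS w : second_derived_pre R w -> ev g w = 1%g.
  by move=> sw; apply/gK; [exact: FG_second sw|apply: gen_S; right].
have gL w : lcs d.+3 w -> ev g w = 1%g.
  by move=> lw; apply/gK; [exact: FG_lcs lw|apply: gen_S; left].
have gR w : R w -> ev g w = 1%g.
  move=> Rw; apply: gS; apply: gen_S; left; apply: gen_S.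
  exists (one E), w; do !split=> //.
  by rewrite /mul /inv /= cats0 !(FG_McCool Rw).
pose M := metabelian_quotient g_surj gS.
have nilM : nilpotent M d := nilpotent_quotient g_surj M gL.
have fP : chen_system (chen_fun M d (letter_of g)).
  apply: (chen_funP nilM); [exact: letter_diag|exact: letter_disj|exact: letter_target|exact: letter_path].
set f := chen_fun _ _ _ in fP.
pose W := span_int (chen_basis (d := d) f).
have spanA x : x \in xs -> exists2 v : der M, dval v = ev g x & W v.
  have surj y : exists w, y = ev g w by have [w [_ ->]] := g_surj y; exists w.
  move=> /xsA; apply: (ev_gen (P := fun y => exists2 v : der M, dval v = y & W v)).
  - by exists 0%R => //; exact: span_int0.
  - by move=> y [v <- Wv]; exists (- v)%R => //; exact: span_intN.
  - by move=> y z [v <- Wv] [v' <- Wv']; exists (v + v')%R => //; exact: span_intD.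
  move=> w [lw|sw]; last by exists 0%R; [rewrite gS|exact: span_int0].
  have [v vE fv] := ev_lcs nilM surj lw; exists v => //.
  (* [filt] quantifies over all closed predicates, so it is applied to the span itself: longer
     monomials vanish by nilpotency, and those of length d are covered by [span_chen]. *)
  apply: fv; first by split; [exact: span_int0|exact: span_intD|exact: span_intN].
  move=> a b u; rewrite leq_eqVlt => /orP [/eqP su|su]; last first.
    by rewrite (foldX_nil_ge nilM) ?size_map //; exact: span_int0.
  have <- : f (val a) (val b) (map val u) = foldX (br M (g a) (g b)) (map g u).
    rewrite /f /chen_fun size_map -su eqxx !letter_val -map_comp.
    by congr foldX; apply: eq_map => x'; exact: letter_val.
  by apply: span_chen; rewrite ?size_map.
have vex (x : word E) : exists v : der M, x \in xs -> ev g x = dval v /\ W v.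
  have [xx|xx] := boolP (x \in xs); last by exists 0%R.
  by have [v vE Wv] := spanA x xx; exists v.
have [v vP] := choice vex.
set r := #|{: chen_index n d}| in sxs.
pose y (i : 'I_r.+1) := nth (one E) xs i.
have yxs i : y i \in xs by rewrite mem_nth // sxs.
have [m mP] := choice (fun i : 'I_r.+1 => (vP _ (yxs i)).2).
(* Rows are the given words, columns the members of the spanning family. *)
have [c [i0 ci0] cM] := int_left_kernel
  (\matrix_(i < r.+1, t < r) m i (enum_val (A := {: chen_index n d}) t))%R.
pose cs := [seq c i | i <- enum 'I_r.+1].
have scs : size cs = r.+1 by rewrite size_map size_enum_ord.
have nth_cs (i : 'I_r.+1) : nth 0%R cs i = c i.
  by rewrite (nth_map ord0) ?size_enum_ord // nth_ord_enum.
have B1 : chen_lcs_pre R d.+3 (prodz xs cs).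
  apply/gK; first exact: FG_prodz.
  rewrite (@ev_prodz _ _ g _ (@dval Q M) erefl _ xs cs v) //; last first.
    by move=> x /vP [].
  rewrite (zip_sum (one E) v sxs scs) (_ : (\sum_(i < _) _)%R = 0%R) //.
  under eq_bigr => i _ do rewrite -/(y i) mP nth_cs mulrz_suml.
  rewrite exchange_big big1 // => t _ /=.
  rewrite (eq_bigr (fun i : 'I_r.+1 => chen_basis f t *~ (c i * m i t)))%R; last first.
    by move=> i _; rewrite [in RHS]mulrC mulrzA.
  rewrite -mulrz_sumr; have := cM (enum_rank t).
  under eq_bigr => i _ do rewrite mxE enum_rankK.
  by move=> ->; rewrite mulr0z.
have := ind cs _ B1 (c i0); rewrite scs sxs => /(_ erefl) H.
by move: ci0; rewrite H ?eqxx //; apply: map_f; rewrite mem_enum.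
Qed.
End Upper.

(** * Affine groups *)

Local Open Scope ring_scope.

Section Affine.
Variable R : comUnitRingType.

(* The pair [(p, v)] stands for the affine map [x |-> v + p x]. *)
Definition aff := {x : R * R | x.1 \is a GRing.unit}.
HB.instance Definition _ := Choice.on aff.
HB.instance Definition _ := SubType.on aff.

Definition mkaff p v (up : p \is a GRing.unit) : aff :=
  exist (fun x : R * R => x.1 \is a GRing.unit) (p, v) up.
Definition lin (x : aff) := (val x).1.
Definition tr (x : aff) := (val x).2.

Lemma lin_unit (x : aff) : lin x \is a GRing.unit.
Proof. by case: x. Qed.

Lemma aff_eq (x y : aff) : lin x = lin y -> tr x = tr y -> x = y.
Proof.
by case: x => [[p v] up]; case: y => [[q w] uq] /= E1 E2; apply: val_inj; congr pair.
Qed.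

Lemma mul_unit (x y : aff) : lin x * lin y \is a GRing.unit.
Proof. by rewrite unitrM !lin_unit. Qed.
Lemma inv_unit (x : aff) : (lin x)^-1 \is a GRing.unit.
Proof. by rewrite unitrV lin_unit. Qed.

Definition amul (x y : aff) : aff := mkaff (tr x + lin x * tr y) (mul_unit x y).
Definition ainv (x : aff) : aff := mkaff (- ((lin x)^-1 * tr x)) (inv_unit x).
Definition transl v : aff := mkaff v (unitr1 R).

Lemma amulA : associative amul.
Proof.
move=> x y z; apply: aff_eq; rewrite /lin /tr /=; first exact: mulrA.
by rewrite mulrDr addrA mulrA.
Qed.
Lemma amul1 : left_id (transl 0) amul.
Proof. by move=> x; apply: aff_eq; rewrite /lin /tr /= ?mul1r ?add0r. Qed.
Lemma amul1r : right_id (transl 0) amul.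
Proof. by move=> x; apply: aff_eq; rewrite /lin /tr /= ?mulr1 ?mulr0 ?addr0. Qed.
Lemma amulV : left_inverse (transl 0) ainv amul.
Proof.
move=> x; apply: aff_eq; rewrite /lin /tr /= ?addNr //.
by rewrite mulVr // lin_unit.
Qed.
Lemma amulrV : right_inverse (transl 0) ainv amul.
Proof.
move=> x; apply: aff_eq; rewrite /lin /tr /=; first by rewrite mulrV // lin_unit.
by rewrite mulrN mulVKr ?subrr // lin_unit.
Qed.
HB.instance Definition _ := isGroup.Build aff amulA amul1 amul1r amulV amulrV.

Lemma lin1 : lin 1%g = 1. Proof. by []. Qed.
Lemma linM (x y : aff) : lin (x * y)%g = lin x * lin y. Proof. by []. Qed.
Lemma linV (x : aff) : lin (x^-1)%g = (lin x)^-1. Proof. by []. Qed.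
Lemma trM (x y : aff) : tr (x * y)%g = tr x + lin x * tr y. Proof. by []. Qed.
Lemma linT v : lin (transl v) = 1. Proof. by []. Qed.
Lemma trT v : tr (transl v) = v. Proof. by []. Qed.
Lemma T0 : transl 0 = 1%g. Proof. by []. Qed.
Lemma TD v w : transl (v + w) = (transl v * transl w)%g.
Proof. by apply: aff_eq; rewrite /lin /tr /= mul1r. Qed.
Lemma T_eq1 v : transl v = 1%g -> v = 0. Proof. by move=> /(congr1 tr). Qed.

Definition brk (x y : aff) := (lin x - 1) * tr y - (lin y - 1) * tr x.

(** Linear parts commute, so a commutator is a translation; in particular affine groups are
    metabelian. *)
Lemma comgE x y : comg x y = transl (brk x y).
Proof.
have E : (x * y = transl (brk x y) * (y * x))%g.
  apply: aff_eq; first by rewrite !linM linT mul1r mulrC.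
  by rewrite !trM linT trT /brk; ring.
by rewrite /comg E !mulgA !mulgK.
Qed.

Lemma comgT x v : comg x (transl v) = transl ((lin x - 1) * v).
Proof. by rewrite comgE /brk linT trT subrr mul0r subr0. Qed.

Section Letters.
Variables (E : eqType) (g : E -> aff).

Fixpoint iter_comm (ws : seq (word E)) (z : word E) : word E :=
  if ws is u :: ws' then comm u (iter_comm ws' z) else z.

Lemma ev_iter_comm ws z v : ev g z = transl v ->
  ev g (iter_comm ws z) = transl (\prod_(u <- ws) (lin (ev g u) - 1) * v).
Proof.
move=> zE; elim: ws => [|u ws IH]; first by rewrite big_nil mul1r.
by rewrite big_cons /= ev_comm IH comgT mulrA.
Qed.

Lemma iter_comm_lcs ws u v : FG u -> FG v -> all (fun w => reduce w == w) ws ->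
  lcs (size ws).+2 (iter_comm ws (comm u v)).
Proof.
move=> Fu Fv; elim: ws => [|w ws IH] /=; first by move=> _; apply: gen_S; exists u, v.
by move=> /andP [/eqP Fw Fws]; apply: gen_S; exists w, (iter_comm ws (comm u v)); do !split=> //; exact: IH.
Qed.

Section Vanish.
Variables (tau : R) (d : nat) (Rel : word E -> Prop).
Hypotheses (tau0 : tau ^+ d.+2 = 0) (g_tau : forall a, exists r, lin (g a) = 1 + tau * r)
  (gRel : forall w, Rel w -> ev g w = 1%g).

Lemma lin_ev w : exists r, lin (ev g w) - 1 = tau * r.
Proof.
elim: w => [|[a b] w [r rE]] /=; first by exists 0; rewrite lin1 subrr mulr0.
have [s sE] : exists s, lin (ev_letter g (a, b)) - 1 = tau * s.
  have [s sE] := g_tau a; rewrite /ev_letter /=; case: b; last first.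
    by exists s; rewrite sE addrC addKr.
  exists (- (s * (lin (g a))^-1)); rewrite linV.
  by apply: (mulIr (lin_unit (g a))); rewrite mulrBl mulVr ?lin_unit // mul1r {1}sE
    mulrN mulrA mulNr mulrVK ?lin_unit // opprD addrA subrr sub0r.
exists (s * lin (ev g w) + r); rewrite linM mulrDr mulrA -sE -rE; ring.
Qed.

(** The innermost bracket already carries one factor [tau], and every further commutator gains
    another. *)
Lemma lcs_T j w : lcs j.+2 w -> exists r, ev g w = transl (tau ^+ j.+1 * r).
Proof.
have gen_case i (S : word E -> Prop) u :
    (forall u', S u' -> exists r, ev g u' = transl (tau ^+ i * r)) ->
    gen S u -> exists r, ev g u = transl (tau ^+ i * r).
  move=> HS; apply: (ev_gen (P := fun x => exists r, x = transl (tau ^+ i * r))) => //.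
  - by exists 0; rewrite mulr0.
  - move=> x [r ->]; exists (- r); apply/mulg1_eq.
    by rewrite -TD mulrN subrr.
  - by move=> x y [r ->] [s ->]; exists (r + s); rewrite -TD mulrDr.
elim: j w => [|j IH] w; apply: gen_case => w' [u [v [_ [lv ->]]]]; rewrite ev_comm.
  rewrite comgE /brk; have [r ->] := lin_ev u; have [s ->] := lin_ev v.
  by exists (r * tr (ev g v) - s * tr (ev g u)); congr transl; ring.
have [r ->] := IH v lv; have [s sE] := lin_ev u.
by exists (s * r); rewrite comgT sE [in RHS]exprS; congr transl; ring.
Qed.

(** Weight d + 3 gives translations by multiples of [tau ^+ d.+2], which is 0; relators vanish by
    hypothesis; and F'' vanishes because translations commute. *)
Lemma chen_vanish w : chen_lcs_pre Rel d.+3 w -> ev g w = 1%g.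
Proof.
have genT (S : word E -> Prop) u : (forall u', S u' -> ev g u' = 1%g) ->
    gen S u -> ev g u = 1%g.
  move=> HS; apply: (ev_gen (P := fun x => x = 1%g)) => //.
    by move=> x ->; rewrite invg1.
  by move=> x y -> ->; rewrite mulg1.
move=> cw; apply: (genT _ _ _ cw) => u [lu|su].
  by have [r ->] := lcs_T lu; rewrite tau0 mul0r.
apply: (genT _ _ _ su) => y [ny|cy].
  apply: (genT _ _ _ ny) => z [h [r [_ [Rr ->]]]].
  by rewrite !ev_mul ev_inv (gRel Rr) mulg1 mulgV.
apply: (genT _ _ _ cy) => z [a [b [la [lb ->]]]]; rewrite ev_comm.
have [r ->] := @lcs_T 0 a la; have [s ->] := @lcs_T 0 b lb.
by rewrite comgT linT subrr mul0r.
Qed.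
End Vanish.
End Letters.
End Affine.

(** A polynomial with infinitely many roots is zero; injectivity of [e] keeps its monomials
    apart. *)
Lemma sum_expn_eq0 (I : finType) (e : I -> nat) (c : I -> int) : injective e ->
  (forall x : nat, (0 < x)%N -> \sum_t c t * x%:R ^+ e t = 0) -> forall t, c t = 0.
Proof.
move=> e_inj H t; pose p : {poly int} := \sum_t c t *: 'X^(e t).
have p0 : p = 0.
  apply: (@roots_geq_poly_eq0 _ p [seq (i.+1)%:R | i <- iota 0 (size p)]).
  - apply/allP => _ /mapP [i _ ->]; rewrite /root /p horner_sum.
    by apply/eqP; rewrite -[RHS](H i.+1) //; apply: eq_bigr => s _; rewrite hornerZ hornerXn.
  - rewrite map_inj_uniq ?iota_uniq // => i j /eqP.
    by rewrite eqr_nat => /eqP [].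
  - by rewrite size_map size_iota.
have := congr1 (fun q : {poly int} => q`_(e t)) p0.
rewrite coef0 /p coef_sum (bigD1 t) //= coefZ coefXn eqxx mulr1 big1 ?addr0 //.
by move=> s st; rewrite coefZ coefXn (inj_eq e_inj) eq_sym (negPf st) mulr0.
Qed.

(** The hypothesis says that m divides s for every m > 1, and m = |s| + 2 exceeds |s|. This is how
    identities over the rings Z/m^(d+2) become identities over the integers. *)
Lemma int_eq0_Zp (s : int) d :
  (forall m, (1 < m)%N -> s%:~R * m%:R ^+ d.+1 = 0 :> 'Z_(m ^ d.+2)) -> s = 0.
Proof.
pose m := (absz s).+2; move=> /(_ m isT) H.
have m1 : (1 < m ^ d.+2)%N by rewrite -(exp1n d.+2) ltn_exp2r.
have H' : (absz s * m ^ d.+1)%:R = 0 :> 'Z_(m ^ d.+2).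
  rewrite natrM natrX; case: (intP s) H => [|k|k]; first by rewrite !mul0r.
    by [].
  by rewrite abszN mulrNz mulNr => /eqP; rewrite oppr_eq0 => /eqP.
have : (absz s * m ^ d.+1 %% m ^ d.+2 = 0)%N by rewrite -val_Zp_nat // H'.
move=> /eqP; rewrite -/(dvdn _ _) expnS dvdn_pmul2r ?expn_gt0 //.
move=> dv; apply/eqP; rewrite -absz_eq0; apply: contraTT dv => s0.
by rewrite gtnNdvd // lt0n.
Qed.

(** * The lower bound *)

Section ChenWords.
Variables n d : nat.
Notation E := (PSgen n).

Definition wordE (p : 'I_n * 'I_n) : word E := if insub p is Some e then gen1 e else one E.

Definition fword a b (w : seq ('I_n * 'I_n)) : word E :=
  iter_comm (map wordE w) (comm (wordE a) (wordE b)).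

(* The product of the [beta_kj] over all [k]; it dies in every [F_3]. *)
Definition target_word (j : 'I_n) : word E :=
  foldr (@mul E) (one E) [seq wordE (k, j) | k <- enum 'I_n].

(** Words of weight d + 2 matched with [chen_index]. For pairs the outer letters are target words
    rather than beta_ij and beta_ji: these become translations under every [triple_hom], so no
    correction as in [hbr] is needed. *)
Definition chen_word (x : chen_index n d) : word E :=
  match x with
  | inl (t, p) =>
      let i := tnth (val t) (inord 0) in let j := tnth (val t) (inord 1) in
      iter_comm (nseq p (target_word j) ++ nseq (d - p) (target_word i))
        (comm (wordE (i, j)) (wordE (j, i)))
  | inr (t, y) =>
      let i := tnth (val t) (inord 0) in let j := tnth (val t) (inord 1) in
      let k := tnth (val t) (inord 2) in
      match y with
      | inl (inl pq) => fword (i, j) (j, k)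
          (mono i j k (tri1 pq) (tri2 pq) (d - tri1 pq - tri2 pq))
      | inl (inr pq) => fword (j, k) (k, i)
          (mono i j k (tri1 pq) (tri2 pq) (d - tri1 pq - tri2 pq))
      | inr p => fword (k, i) (i, j) (mono i j k p (d - p) 0)
      end
  end.

Lemma FG_wordE p : FG (wordE p).
Proof. by rewrite /wordE; case: insubP. Qed.

Lemma FG_target_word j : FG (target_word j).
Proof. by rewrite /target_word; case: (enum _) => //= *; exact: FG_mul. Qed.

Lemma fword_lcs a b w : lcs (size w).+2 (fword a b w).
Proof.
rewrite -(size_map wordE); apply: iter_comm_lcs; try exact: FG_wordE.
by apply/allP => _ /mapP [p _ ->]; apply/eqP; exact: FG_wordE.
Qed.

Lemma chen_word_lcs x : lcs d.+2 (chen_word x).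
Proof.
case: x => [[t p]|[t [[pq|pq]|p]]] /=.
- set ws := _ ++ _; have -> : d = size ws.
    by rewrite size_cat !size_nseq subnKC // -ltnS.
  apply: iter_comm_lcs; try exact: FG_wordE.
  rewrite all_cat !all_nseq; apply/andP; split; apply/orP; right; apply/eqP; exact: FG_target_word.
- set w := mono _ _ _ _ _ _; have -> : d = size w; last exact: fword_lcs.
  by rewrite /w /mono !size_cat !size_nseq; have := valP pq; rewrite /tri1 /tri2; lia.
- set w := mono _ _ _ _ _ _; have -> : d = size w; last exact: fword_lcs.
  by rewrite /w /mono !size_cat !size_nseq; have := valP pq; rewrite /tri1 /tri2; lia.
set w := mono _ _ _ _ _ _; have -> : d = size w; last exact: fword_lcs.
by rewrite /w /mono !size_cat !size_nseq; have := ltn_ord p; lia.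
Qed.

Section Hom.
Variables (R : comUnitRingType) (tau : R) (G : 'I_n * 'I_n -> aff R).
Hypotheses (tau0 : tau ^+ d.+2 = 0).

Record mccool_hom : Prop := McCoolHom {
  mh_lin : forall p, exists r, lin (G p) = 1 + tau * r;
  mh_diag : forall i, G (i, i) = 1%g;
  mh_disj : forall i j k l, uniq [:: i; j; k; l] -> comg (G (i, j)) (G (k, l)) = 1%g;
  mh_target : forall i j k, uniq [:: i; j; k] -> comg (G (i, k)) (G (j, k)) = 1%g;
  mh_path : forall i j k, uniq [:: i; j; k] ->
    comg (G (i, j)) (G (i, k) * G (j, k))%g = 1%g }.

Hypothesis GP : mccool_hom.
Let g (e : E) := G (val e).

Lemma ev_wordE p : ev g (wordE p) = G p.
Proof.
rewrite /wordE; case: insubP => [e _ <-|]; first by rewrite ev_gen1.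
by case: p => i j /=; rewrite negbK => /eqP <-; rewrite (mh_diag GP).
Qed.

Lemma ev_McCool w : @McCool_rel n w -> ev g w = 1%g.
Proof.
have gE (e : E) : g e = G (src e, tgt e) by rewrite /g /src /tgt; case: (val e).
move=> [[a [b [U ->]]]|[[a [b [tE [U ->]]]]|[a [b [c [sE [tE [tsE [U ->]]]]]]]]].
- by rewrite ev_comm !ev_gen1 !gE (mh_disj GP).
- by rewrite ev_comm !ev_gen1 !gE tE (mh_target GP) // -tE.
by rewrite ev_comm ev_mul !ev_gen1 !gE -tE -sE -tsE (mh_path GP).
Qed.

Lemma lin_target_word j : lin (ev g (target_word j)) = \prod_k lin (G (k, j)).
Proof.
rewrite /target_word -[RHS]big_enum /=.
elim: (enum _) => [|k s IH]; first by rewrite big_nil.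
by rewrite /= ev_mul linM IH big_cons ev_wordE.
Qed.

Lemma ev_fword a b w :
  ev g (fword a b w) = transl (\prod_(c <- w) (lin (G c) - 1) * brk (G a) (G b)).
Proof.
rewrite (@ev_iter_comm _ _ g _ _ (brk (G a) (G b))).
  by rewrite big_map; congr (transl (_ * _)); apply: eq_bigr => c _; rewrite ev_wordE.
by rewrite ev_comm !ev_wordE comgE.
Qed.

Lemma lin_chen_word x : ev g (chen_word x) = transl (tr (ev g (chen_word x))).
Proof.
have linT0 y : lin y = 1 -> y = transl (tr y) by move=> yE; apply: aff_eq.
apply: linT0.
case: x => [[t p]|[t [[pq|pq]|p]]] /=; rewrite ?ev_fword //.
by rewrite (@ev_iter_comm _ _ g _ _ _ (etrans (ev_comm _ _ _) (comgE _ _))).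
Qed.

(** Each homomorphism to an affine group turns a dependence modulo weight d + 3 into one linear
    equation on its coefficients. *)
Lemma chen_relation (cs : seq int) (c : chen_index n d -> int) :
  cs = [seq c x | x <- enum {: chen_index n d}] ->
  chen_lcs_pre (@McCool_rel n) d.+3
    (prodz [seq chen_word x | x <- enum {: chen_index n d}] cs) ->
  \sum_x tr (ev g (chen_word x)) *~ c x = 0.
Proof.
move=> -> /(@chen_vanish _ _ g tau d _ tau0 (fun e => mh_lin GP (val e)) ev_McCool).
rewrite (@ev_prodz _ _ g _ (@transl R) erefl (@TD R) _ _ (fun w => tr (ev g w))); last first.
  by move=> _ /mapP [x _ ->]; exact: lin_chen_word.
move=> /T_eq1; rewrite zip_map big_map big_enum //.
Qed.
End Hom.
End ChenWords.

Lemma comg1 (G : groupType) (x : G) : comg x 1%g = 1%g.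
Proof. by rewrite /comg mulg1 mulgV mul1g invg1. Qed.

Lemma com1g (G : groupType) (x : G) : comg 1%g x = 1%g.
Proof. by rewrite /comg mul1g invg1 mulg1 mulgV. Qed.

Lemma comgg (G : groupType) (x : G) : comg x x = 1%g.
Proof. by rewrite /comg mulgK mulgV. Qed.

Lemma comgVr (G : groupType) (x : G) : comg x x^-1%g = 1%g.
Proof. by rewrite /comg mulgV mul1g invgK mulVg. Qed.

Lemma comgVl (G : groupType) (x : G) : comg x^-1%g x = 1%g.
Proof. by rewrite /comg mulVg mul1g invgK mulgV. Qed.

Ltac eqs := repeat match goal with
  | h : is_true (negb (?x == ?x)) |- _ => by rewrite eqxx in h
  | |- context [@eq_op ?T ?x ?gy] =>
      let h := fresh "h" in
      case: (eqVneq x gy) => [h|h]; [subst|]; rewrite ?eqxx //=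
  end.

(** * Homomorphisms through F_2 and F_3 to affine groups *)

Section Homs.
Variables (n d : nat) (R : comUnitRingType) (tau : R).
Hypotheses (tau0 : tau ^+ d.+2 = 0) (tauU : forall l : nat, 1 + tau * l%:R \is a GRing.unit).
Variables (lam mu : 'I_n -> nat).
Local Notation I := 'I_n.

(** The image of the free generator y_j, the map x |-> mu_j + (1 + tau lam_j) x. *)
Definition gy (j : I) : aff R := mkaff (mu j)%:R (tauU (lam j)).

Lemma lin_y j : lin (gy j) = 1 + tau * (lam j)%:R. Proof. by []. Qed.
Lemma lin_y1 j : lin (gy j) - 1 = tau * (lam j)%:R.
Proof. by rewrite lin_y addrC addKr. Qed.

Definition bracket (i j : I) : int := (lam i * mu j)%:R - (lam j * mu i)%:R.

Lemma brk_y i j : brk (gy i) (gy j) = tau * (bracket i j)%:~R.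
Proof. by rewrite /brk !lin_y1 /bracket /tr /= rmorphB /= !natrM; ring. Qed.

(** Factors through the free group on y_a and y_b. *)
Definition pair_hom (a b : I) (p : I * I) : aff R :=
  if p \in [:: (a, b); (b, a)] then gy p.2 else 1%g.

(** Factors through the free group on y_a, y_b, y_c. The two generators with a common target in the
    triple go to inverse elements, which makes beta_ik beta_jk trivial and so respects the third
    kind of relator. *)
Definition triple_hom (a b c : I) (p : I * I) : aff R :=
  if p \in [:: (c, a); (a, b); (b, c)] then gy p.2
  else if p \in [:: (b, a); (c, b); (a, c)] then (gy p.2)^-1%g else 1%g.

Let linU j : exists r, lin (gy j) = 1 + tau * r.
Proof. by exists (lam j)%:R. Qed.

Let lin1U : exists r, lin (1%g : aff R) = 1 + tau * r.
Proof. by exists 0; rewrite mulr0 addr0. Qed.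

Let linVU j : exists r, lin ((gy j)^-1)%g = 1 + tau * r.
Proof.
exists (- ((lam j)%:R * (lin (gy j))^-1)); rewrite linV mulrN mulrA.
apply: (mulIr (lin_unit (gy j))).
by rewrite mulrBl mulVr ?lin_unit // mul1r mulrVK ?lin_unit // lin_y addrK.
Qed.

Lemma pair_homP a b : a != b -> mccool_hom tau (pair_hom a b).
Proof.
move=> ab; split; rewrite /pair_hom.
- by move=> p; case: ifP => _; [exact: linU|exact: lin1U].
- by move=> i; rewrite !inE !xpair_eqE; move: ab; eqs.
- move=> i j k l; rewrite /= !inE !xpair_eqE.
  by move: ab; eqs => *; rewrite ?comg1 ?com1g.
- move=> i j k; rewrite /= !inE !xpair_eqE.
  by move: ab; eqs => *; rewrite ?comg1 ?com1g.
move=> i j k; rewrite /= !inE !xpair_eqE.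
by move: ab; eqs => *; rewrite ?mulg1 ?comg1 ?com1g.
Qed.

Lemma triple_homP a b c : uniq [:: a; b; c] -> mccool_hom tau (triple_hom a b c).
Proof.
move=> U; split; rewrite /triple_hom.
- by move=> p; do 2?case: ifP => _; [exact: linU|exact: linVU|exact: lin1U].
- by move=> i; rewrite !inE !xpair_eqE; move: U; rewrite /= !inE; eqs.
- move=> i j k l; rewrite /= !inE !xpair_eqE.
  by move: U; rewrite /= !inE; eqs => *; rewrite ?comg1 ?com1g.
- move=> i j k; rewrite /= !inE !xpair_eqE.
  by move: U; rewrite /= !inE; eqs => *; rewrite ?comg1 ?com1g ?comgVr ?comgVl.
move=> i j k; rewrite /= !inE !xpair_eqE.
by move: U; rewrite /= !inE; eqs => *; rewrite ?mulgV ?mulVg ?mulg1 ?mul1g ?comg1 ?com1g.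
Qed.

Definition letters (G : I * I -> aff R) (e : PSgen n) := G (val e).

Lemma brk1l (x : aff R) : brk 1%g x = 0.
Proof. by rewrite /brk lin1 subrr mul0r mulr0 subr0. Qed.

Lemma brk1r (x : aff R) : brk x 1%g = 0.
Proof. by rewrite /brk lin1 subrr mul0r mulr0 subr0. Qed.

Lemma incr2P (t : incr_tuple n 2) : (tnth (val t) (inord 0) < tnth (val t) (inord 1))%N.
Proof.
case: t => [[[|a [|b [|c s]]] // st] inc] /=.
by rewrite !(tnth_nth a) !inordK //=; move: inc => /= /andP [].
Qed.

Lemma incr3P (t : incr_tuple n 3) :
  (tnth (val t) (inord 0) < tnth (val t) (inord 1))%N /\
  (tnth (val t) (inord 1) < tnth (val t) (inord 2))%N.
Proof.
case: t => [[[|a [|b [|c [|e s]]]] // st] inc] /=.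
by rewrite !(tnth_nth a) !inordK //=; move: inc => /= /and3P [-> ->].
Qed.

Lemma incr2_inj (t t' : incr_tuple n 2) :
  tnth (val t) (inord 0) = tnth (val t') (inord 0) ->
  tnth (val t) (inord 1) = tnth (val t') (inord 1) -> t = t'.
Proof.
case: t => [[[|a [|b [|c s]]] // st] inc]; case: t' => [[[|a' [|b' [|c' s']]] // st'] inc'] /=.
rewrite !(tnth_nth a) !inordK //= => E1 E2; apply: val_inj; apply: val_inj => /=.
by rewrite E1 E2.
Qed.

Lemma incr3_inj (t t' : incr_tuple n 3) :
  tnth (val t) (inord 0) = tnth (val t') (inord 0) ->
  tnth (val t) (inord 1) = tnth (val t') (inord 1) ->
  tnth (val t) (inord 2) = tnth (val t') (inord 2) -> t = t'.
Proof.
case: t => [[[|a [|b [|c [|e s]]]] // st] inc].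
case: t' => [[[|a' [|b' [|c' [|e' s']]]] // st'] inc'] /=.
rewrite !(tnth_nth a) !inordK //= => E1 E2 E3; apply: val_inj; apply: val_inj => /=.
by rewrite E1 E2 E3.
Qed.

(** Three distinct indices do not fit in {a, b}, so one of the two letters goes to 1. Pair
    homomorphisms therefore do not see the words of triples. *)
Lemma pair_hom_path a b i j k : a != b -> uniq [:: i; j; k] -> 
  brk (pair_hom a b (i, j)) (pair_hom a b (j, k)) = 0.
Proof.
rewrite /pair_hom /= !inE !xpair_eqE.
by eqs => *; rewrite ?brk1l ?brk1r.
Qed.

Lemma lin_target_pair a b j : a != b -> j \in [:: a; b] -> 
  lin (ev (letters (pair_hom a b)) (target_word j)) = lin (gy j).
Proof.
move=> ab; rewrite (lin_target_word (pair_homP ab)) !inE => /orP [] /eqP ->.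
  rewrite (bigD1 b) //= big1 ?mulr1 => [|k kb].
    by rewrite /pair_hom !inE !eqxx orbT.
  rewrite /pair_hom !inE !xpair_eqE.
  by move: kb ab; eqs.
rewrite (bigD1 a) //= big1 ?mulr1 => [|k kb].
  by rewrite /pair_hom !inE !eqxx.
rewrite /pair_hom !inE !xpair_eqE.
by move: kb ab; eqs.
Qed.

(** For j in the triple, the only nontrivial factors are y_j and its inverse; otherwise all factors
    are 1. *)
Lemma lin_target_triple a b c j : uniq [:: a; b; c] ->
  lin (ev (letters (triple_hom a b c)) (target_word j)) = 1.
Proof.
move=> U; rewrite (lin_target_word (triple_homP U)).
set G := triple_hom a b c.
have prod1 k1 k2 : k1 != k2 -> G (k1, j) = gy j -> G (k2, j) = (gy j)^-1%g ->
    (forall k, k != k1 -> k != k2 -> G (k, j) = 1%g) -> \prod_k lin (G (k, j)) = 1.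
  move=> k12 E1 E2 E3; rewrite (bigD1 k1) //= (bigD1 k2) 1?eq_sym //= big1.
    by rewrite E1 E2 mulr1 linV mulrV // lin_unit.
  by move=> k /andP [k1' k2']; rewrite E3.
have [ja|ja] := eqVneq j a.
  apply: (prod1 c b); rewrite /G /triple_hom ?inE ?xpair_eqE; move: U; rewrite /= !inE; subst j.
  - by eqs.
  - by eqs.
  - by eqs.
  by move=> U' k; rewrite !inE !xpair_eqE; move: U'; eqs.
have [jb|jb] := eqVneq j b.
  apply: (prod1 a c); rewrite /G /triple_hom ?inE ?xpair_eqE; move: U; rewrite /= !inE; subst j.
  - by eqs.
  - by eqs.
  - by eqs.
  by move=> U' k; rewrite !inE !xpair_eqE; move: U'; eqs.
have [jc|jc] := eqVneq j c.
  apply: (prod1 b a); rewrite /G /triple_hom ?inE ?xpair_eqE; move: U; rewrite /= !inE; subst j.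
  - by eqs.
  - by eqs.
  - by eqs.
  by move=> U' k; rewrite !inE !xpair_eqE; move: U'; eqs.
rewrite big1 // => k _; rewrite /G /triple_hom !inE !xpair_eqE.
by rewrite (negPf ja) (negPf jb) (negPf jc) !andbF.
Qed.
Section PairValues.
Variable t0 : incr_tuple n 2.
Let a := tnth (val t0) (inord 0).
Let b := tnth (val t0) (inord 1).
Let G := pair_hom a b.
Let g := letters G.

Let ab : a != b.
Proof. by rewrite neq_ltn incr2P. Qed.

Let GP : mccool_hom tau G := pair_homP ab.

Definition pair_val (p : 'I_d.+1) : int :=
  (lam b)%:R ^+ p * (lam a)%:R ^+ (d - p) * bracket b a.

Lemma pair_value p :
  tr (ev g (chen_word (inl (t0, p)))) = tau ^+ d.+1 * (pair_val p)%:~R.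
Proof.
rewrite /chen_word -/a -/b.
rewrite (@ev_iter_comm _ _ g _ _ _ (etrans (ev_comm _ _ _) (comgE _ _))) trT.
rewrite !(ev_wordE GP) big_cat !big_nseq !iter_mulr_1 !lin_target_pair ?inE ?eqxx ?orbT //.
rewrite !lin_y1 /G /pair_hom !inE !eqxx ?orbT /= brk_y.
have -> : tau ^+ d.+1 = tau * (tau ^+ p * tau ^+ (d - p)).
  by rewrite -exprD subnKC -?exprS // -ltnS.
by rewrite /pair_val !rmorphM !rmorphXn /= !exprMn !rmorph_nat; ring.
Qed.

Lemma pair_other t (p : 'I_d.+1) : t != t0 -> tr (ev g (chen_word (inl (t, p)))) = 0.
Proof.
move=> tt; rewrite /chen_word.
rewrite (@ev_iter_comm _ _ g _ _ _ (etrans (ev_comm _ _ _) (comgE _ _))) trT.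
rewrite !(ev_wordE GP).
set j := tnth _ _; set i := tnth _ _; suff -> : G (i, j) = 1%g by rewrite brk1l mulr0.
have ij := incr2P t; rewrite -/i -/j in ij; have ab' := incr2P t0; rewrite -/a -/b in ab'.
rewrite /G /pair_hom !inE !xpair_eqE; case: ifP => // /orP [] /andP [/eqP E1 /eqP E2].
  by case/eqP: tt; apply: incr2_inj.
by move: ij ab'; rewrite E1 E2 => H1 H2; have := ltn_trans H1 H2; rewrite ltnn.
Qed.

Lemma pair_triple t (z : tri d + tri d + 'I_d.+1) : tr (ev g (chen_word (inr (t, z)))) = 0.
Proof.
have [ij jk] := incr3P t.
have U : uniq [:: tnth (val t) (inord 0); tnth (val t) (inord 1); tnth (val t) (inord 2)].
  by rewrite /= !inE !negb_or !neq_ltn ij jk (ltn_trans ij jk).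
case: z => [[pq|pq]|p]; rewrite /chen_word (ev_fword GP) trT pair_hom_path ?mulr0 //.
  by rewrite -(rot_uniq 1) in U.
by rewrite -(rot_uniq 2) in U.
Qed.
End PairValues.

Section TripleValues.
Variable t0 : incr_tuple n 3.
Let a := tnth (val t0) (inord 0).
Let b := tnth (val t0) (inord 1).
Let c := tnth (val t0) (inord 2).
Let G := triple_hom a b c.
Let g := letters G.

Let U : uniq [:: a; b; c].
Proof.
have [ab bc] := incr3P t0.
by rewrite /= !inE !negb_or !neq_ltn ab bc (ltn_trans ab bc).
Qed.

Let GP : mccool_hom tau G := triple_homP U.

Definition triple_mono (p q r : nat) : int :=
  (lam a)%:R ^+ p * (lam b)%:R ^+ q * (lam c)%:R ^+ r.

Definition triple_val (z : tri d + tri d + 'I_d.+1) : int :=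
  match z with
  | inl (inl pq) => triple_mono (tri1 pq) (tri2 pq) (d - tri1 pq - tri2 pq) * bracket b c
  | inl (inr pq) => triple_mono (tri1 pq) (tri2 pq) (d - tri1 pq - tri2 pq) * bracket c a
  | inr p => triple_mono p (d - p) 0 * bracket a b
  end.

Let Gca : G (c, a) = gy a.
Proof. by rewrite /G /triple_hom !inE eqxx. Qed.
Let Gab : G (a, b) = gy b.
Proof. by rewrite /G /triple_hom !inE eqxx !orbT. Qed.
Let Gbc : G (b, c) = gy c.
Proof. by rewrite /G /triple_hom !inE eqxx !orbT. Qed.

Lemma prod_mono p q r : (p + q + r = d)%N ->
  tau * \prod_(x <- mono a b c p q r) (lin (G x) - 1)
  = tau ^+ d.+1 * (triple_mono p q r)%:~R.
Proof.
move=> pqr; rewrite /mono !big_cat !big_nseq !iter_mulr_1 /= Gca Gab Gbc !lin_y1.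
have -> : tau ^+ d.+1 = tau * (tau ^+ p * tau ^+ q * tau ^+ r).
  by rewrite -!exprD pqr exprS.
by rewrite /triple_mono !rmorphM !rmorphXn /= !exprMn !rmorph_nat; ring.
Qed.

Lemma triple_value z :
  tr (ev g (chen_word (inr (t0, z)))) = tau ^+ d.+1 * (triple_val z)%:~R.
Proof.
have tri_sum (pq : tri d) : (tri1 pq + tri2 pq + (d - tri1 pq - tri2 pq) = d)%N.
  by have := valP pq; rewrite /tri1 /tri2; lia.
case: z => [[pq|pq]|p]; rewrite /chen_word (ev_fword GP) trT -/a -/b -/c
    ?Gca ?Gab ?Gbc brk_y /triple_val rmorphM mulrA mulrA -prod_mono //.
- by rewrite [_ * tau]mulrC.
- by rewrite [_ * tau]mulrC.
- by rewrite [_ * tau]mulrC.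
by rewrite addn0 subnKC // -ltnS.
Qed.

(** Since d > 0 the word contains at least one target word, whose operator is zero by
    [lin_target_triple]. *)
Lemma triple_pair t (p : 'I_d.+1) : (0 < d)%N -> tr (ev g (chen_word (inl (t, p)))) = 0.
Proof.
move=> d0; rewrite /chen_word.
rewrite (@ev_iter_comm _ _ g _ _ _ (etrans (ev_comm _ _ _) (comgE _ _))) trT.
rewrite big_cat !big_nseq !iter_mulr_1 !lin_target_triple // subrr.
have [->|p0] := eqVneq (p : nat) 0%N; first by rewrite subn0 (expr0n _ d) (gtn_eqF d0) /= mulr0n mulr0 mul0r.
by rewrite (expr0n _ p) (negPf p0) /= mulr0n !mul0r.
Qed.

Lemma triple_hom_path i j k : uniq [:: i; j; k] ->
  ~~ all (mem [:: a; b; c]) [:: i; j; k] -> brk (G (i, j)) (G (j, k)) = 0.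
Proof.
move=> _; have out p q : (p \notin [:: a; b; c]) || (q \notin [:: a; b; c]) -> G (p, q) = 1%g.
  rewrite /G /triple_hom !inE !xpair_eqE !negb_or.
  case/orP => /and3P [/negPf -> /negPf -> /negPf ->]; rewrite ?andbF //.
rewrite /= andbT !negb_and => /or3P [oi|oj|ok].
- by rewrite out ?oi // brk1l.
- by rewrite out ?oj ?orbT // brk1l.
by rewrite [G (j, k)]out ?ok ?orbT // brk1r.
Qed.

Lemma triple_other t (z : tri d + tri d + 'I_d.+1) :
  t != t0 -> tr (ev g (chen_word (inr (t, z)))) = 0.
Proof.
move=> tt; have [ij jk] := incr3P t; have [ab bc] := incr3P t0.
rewrite -/a -/b -/c in ab bc.
have Ut : uniq [:: tnth (val t) (inord 0); tnth (val t) (inord 1); tnth (val t) (inord 2)].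
  by rewrite /= !inE !negb_or !neq_ltn ij jk (ltn_trans ij jk).
(* An increasing triple with entries among a < b < c must be (a, b, c) itself. *)
have nall : ~~ all (mem [:: a; b; c])
    [:: tnth (val t) (inord 0); tnth (val t) (inord 1); tnth (val t) (inord 2)].
  apply: contraNN tt; rewrite /= !inE andbT => /and3P [H1 H2 H3]; apply/eqP.
  apply: incr3_inj; case/or3P: H1 => /eqP E1; case/or3P: H2 => /eqP E2; case/or3P: H3 => /eqP E3;
    move: ij jk; rewrite E1 E2 E3 // => *; exfalso; lia.
case: z => [[pq|pq]|p]; rewrite /chen_word (ev_fword GP) trT triple_hom_path ?mulr0 //.
- by rewrite -(rot_uniq 1) in Ut.
- by move: nall; rewrite -(perm_all _ (permEl (perm_rot 1 _))).
- by rewrite -(rot_uniq 2) in Ut.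
by move: nall; rewrite -(perm_all _ (permEl (perm_rot 2 _))).
Qed.
End TripleValues.
End Homs.

Lemma sum_prodl (A B : finType) (V : nmodType) (F : A * B -> V) t0 :
  (forall t p, t != t0 -> F (t, p) = 0) -> \sum_x F x = \sum_p F (t0, p).
Proof.
move=> F0; rewrite (eq_bigr (fun x => F (x.1, x.2))); last by case.
rewrite -(pair_bigA _ (fun t p => F (t, p))) (bigD1 t0) //= [X in _ + X]big1 ?addr0 //.
by move=> t tt; apply: big1 => p _; exact: F0.
Qed.

(** * Vanishing of the coefficients of a dependence *)

Section Independence.
Variables (n d : nat) (cs : seq int) (c : chen_index n d -> int).
Hypotheses (d_gt0 : (0 < d)%N) (csE : cs = [seq c x | x <- enum {: chen_index n d}])
  (Bcs : chen_lcs_pre (@McCool_rel n) d.+3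
     (prodz [seq chen_word x | x <- enum {: chen_index n d}] cs)).

Lemma sum_int_Zp (J : finType) (v w : J -> int) m :
  \sum_j (m%:R ^+ d.+1 * (v j)%:~R : 'Z_(m ^ d.+2)) *~ w j
  = (\sum_j v j * w j)%:~R * m%:R ^+ d.+1.
Proof.
rewrite rmorph_sum mulr_suml; apply: eq_bigr => j _.
by rewrite rmorphM /= -mulrzr; ring.
Qed.

Lemma Zp_tau0 m : (1 < m)%N -> m%:R ^+ d.+2 = 0 :> 'Z_(m ^ d.+2).
Proof.
move=> m1; rewrite -natrX pchar_Zp // -(exp1n d.+2) ltn_exp2r //.
Qed.

Lemma Zp_tauU m : (1 < m)%N ->
  forall l : nat, 1 + m%:R * l%:R \is a @GRing.unit 'Z_(m ^ d.+2).
Proof.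
move=> m1 l; rewrite -natrM -[1]/(1%:R) -natrD unitZpE.
  by rewrite coprimeXl // /coprime addnC mulnC gcdnMDl gcdn1.
by rewrite -(exp1n d.+2) ltn_exp2r.
Qed.

(** Use tau = m in Z/m^(d+2) for every m > 1. The words of all triples and of other pairs evaluate
    to zero, so only the block of [t0] is left. *)
Lemma pair_relation (lam mu : 'I_n -> nat) (t0 : incr_tuple n 2) :
  \sum_(p < d.+1) pair_val lam mu t0 p * c (inl (t0, p)) = 0.
Proof.
apply: (@int_eq0_Zp _ d) => m m1; rewrite -sum_int_Zp.
have t0ab : tnth (val t0) (inord 0) != tnth (val t0) (inord 1) by rewrite neq_ltn incr2P.
pose v (x : chen_index n d) := tr (ev (letters (pair_hom (Zp_tauU m1) lam mu (tnth (val t0) (inord 0))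
  (tnth (val t0) (inord 1)))) (chen_word x)).
have : \sum_x v x *~ c x = 0.
  have rel := chen_relation (Zp_tau0 m1) (pair_homP (Zp_tauU m1) lam mu t0ab) csE Bcs.
  exact: rel.
rewrite big_sumType /= [X in _ + X]big1 ?addr0 => [|[t z] _]; last first.
  by rewrite /v pair_triple mul0rz.
rewrite (@sum_prodl _ _ _ (fun x => v (inl x) *~ c (inl x)) t0) => [E0|t p tt]; last first.
  by rewrite /v pair_other ?mul0rz.
by rewrite -[RHS]E0; apply: eq_bigr => p _; rewrite /v pair_value.
Qed.

Lemma triple_relation (lam mu : 'I_n -> nat) (t0 : incr_tuple n 3) :
  \sum_z triple_val lam mu t0 z * c (inr (t0, z)) = 0.
Proof.
apply: (@int_eq0_Zp _ d) => m m1; rewrite -sum_int_Zp.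
have [ab bc] := incr3P t0.
have U : uniq [:: tnth (val t0) (inord 0); tnth (val t0) (inord 1); tnth (val t0) (inord 2)].
  by rewrite /= !inE !negb_or !neq_ltn ab bc (ltn_trans ab bc).
pose v (x : chen_index n d) := tr (ev (letters (triple_hom (Zp_tauU m1) lam mu (tnth (val t0) (inord 0))
  (tnth (val t0) (inord 1)) (tnth (val t0) (inord 2)))) (chen_word x)).
have : \sum_x v x *~ c x = 0.
  have rel := chen_relation (Zp_tau0 m1) (triple_homP (Zp_tauU m1) lam mu U) csE Bcs.
  exact: rel.
rewrite big_sumType /= [X in X + _]big1 ?add0r => [|[t p] _]; last first.
  by rewrite /v triple_pair ?mul0rz.
rewrite (@sum_prodl _ _ _ (fun x => v (inr x) *~ c (inr x)) t0) => [E0|t z tt]; last first.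
  by rewrite /v triple_other ?mul0rz.
by rewrite -[RHS]E0; apply: eq_bigr => z _; rewrite /v triple_value.
Qed.

Lemma pair_coef0 t p : c (inl (t, p)) = 0.
Proof.
have ab : tnth (val t) (inord 0) != tnth (val t) (inord 1) by rewrite neq_ltn incr2P.
move: p; apply: (@sum_expn_eq0 _ (fun p : 'I_d.+1 => p : nat)); first exact: val_inj.
move=> x x0.
(* With lam_b = x, lam_a = 1, mu_a = 1, mu_b = 0 the bracket is x, leaving x times a polynomial in x
   whose coefficients are the wanted ones. *)
have := pair_relation (fun i => if i == tnth (val t) (inord 1) then x else 1%N)
  (fun i => i == tnth (val t) (inord 0)) t.
rewrite /pair_val /bracket !eqxx (negPf ab) eq_sym (negPf ab) muln1 muln0 subr0.
rewrite (eq_bigr (fun p : 'I_d.+1 => c (inl (t, p)) * x%:R ^+ p * x%:R)) => [|p _]; last first.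
  by rewrite expr1n mulr1; ring.
by rewrite -mulr_suml => /eqP; rewrite mulf_eq0 pnatr_eq0 (gtn_eqF x0) orbF => /eqP.
Qed.

(** Kronecker substitution: both exponents are at most d, hence are digits in base d + 1. *)
Lemma tri_exp_inj : injective (fun t : tri d => (tri1 t + d.+1 * tri2 t)%N).
Proof.
move=> [[p q] pq] [[p' q'] pq'] /= E; apply: val_inj => /=.
rewrite /tri1 /tri2 /= in E.
have Ep : p = p' :> nat.
  have := congr1 (modn^~ d.+1) E.
  by rewrite /= ![(_ + d.+1 * _)%N]addnC ![(d.+1 * _)%N]mulnC !modnMDl !modn_small.
have Eq : q = q' :> nat.
  by move/eqP: E; rewrite Ep eqn_add2l eqn_pmul2l // => /eqP.
by congr pair; apply: val_inj.
Qed.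

(** The parameters mu select a family. The two-letter family is isolated first; afterwards each of
    the other two can be isolated, with lam_a = x and lam_b = x^(d+1) encoding two exponents in one
    variable. *)
Lemma triple_coef0 t z : c (inr (t, z)) = 0.
Proof.
pose a := tnth (val t) (inord 0); pose b := tnth (val t) (inord 1).
pose e := tnth (val t) (inord 2).
have [ab0 be0] := incr3P t.
have ab : (a == b) = false by apply/negbTE; rewrite neq_ltn ab0.
have be : (b == e) = false by apply/negbTE; rewrite neq_ltn be0.
have ae : (a == e) = false by apply/negbTE; rewrite neq_ltn (ltn_trans ab0 be0).
pose lam xa xb xe (i : 'I_n) : nat := if i == a then xa else if i == b then xb else xe.
have lamE xa xb xe : [/\ lam xa xb xe a = xa, lam xa xb xe b = xb & lam xa xb xe e = xe].
  by rewrite /lam !eqxx [b == a]eq_sym ab [e == a]eq_sym ae [e == b]eq_sym be.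
have rel xa xb xe ma mb me := triple_relation (lam xa xb xe) (lam ma mb me) t.
have {}rel xa xb xe ma mb me :
    \sum_pq (xa%:R ^+ tri1 pq * xb%:R ^+ tri2 pq * xe%:R ^+ (d - tri1 pq - tri2 pq) *
       ((xb * me)%:R - (xe * mb)%:R)) * c (inr (t, inl (inl pq))) +
    \sum_pq (xa%:R ^+ tri1 pq * xb%:R ^+ tri2 pq * xe%:R ^+ (d - tri1 pq - tri2 pq) *
       ((xe * ma)%:R - (xa * me)%:R)) * c (inr (t, inl (inr pq))) +
    \sum_(p < d.+1) (xa%:R ^+ p * xb%:R ^+ (d - p) *
       ((xa * mb)%:R - (xb * ma)%:R)) * c (inr (t, inr p)) = 0.
  have := rel xa xb xe ma mb me.
  rewrite big_sumType big_sumType /= /triple_mono /bracket -/a -/b -/e.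
  have [-> -> ->] := lamE xa xb xe; have [-> -> ->] := lamE ma mb me.
  by under [X in _ + X]eq_bigr => p _ do rewrite expr0 mulr1.
have c3 p : c (inr (t, inr p)) = 0.
  move: p; apply: (@sum_expn_eq0 _ (fun p : 'I_d.+1 => p : nat)); first exact: val_inj.
  (* Here lam_c = mu_b = mu_c = 0 makes the first two brackets zero, and the third is -1. *)
  move=> x x0; have := rel x 1%N 0%N 1%N 0%N 0%N.
  rewrite [X in X + _ + _]big1 ?add0r => [|pq _]; last by rewrite ?(muln0, mul0n, subrr, oppr0, mulr0, mul0r).
  rewrite [X in X + _]big1 ?add0r => [|pq _]; last by rewrite ?(muln0, mul0n, subrr, oppr0, mulr0, mul0r).
  move=> E; apply/eqP; rewrite -oppr_eq0 -sumrN -[X in _ == X]E; apply/eqP.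
  by apply: eq_bigr => p _; rewrite expr1n muln0 sub0r; ring.
have expE (x : nat) (pq : tri d) :
    x%:R ^+ (tri1 pq + d.+1 * tri2 pq) = x%:R ^+ tri1 pq * (x ^ d.+1)%:R ^+ tri2 pq :> int.
  by rewrite exprD exprM natrX.
case: z => [[z|z]|z]; last exact: c3.
  move: z; apply: (@sum_expn_eq0 _ _ _ tri_exp_inj) => x x0.
  (* With only mu_b nonzero the first bracket is -1 and the second 0; the third is x, but its
     coefficients vanish by [c3]. *)
  have := rel x (x ^ d.+1)%N 1%N 0%N 1%N 0%N.
  rewrite [X in _ + X + _]big1 ?addr0 => [|pq _]; last by rewrite ?(muln0, mul0n, subrr, oppr0, mulr0, mul0r).
  rewrite [X in _ + X]big1 ?addr0 => [|pq _]; last by rewrite c3 mulr0.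
  move=> E; apply/eqP; rewrite -oppr_eq0 -sumrN -[X in _ == X]E; apply/eqP.
  by apply: eq_bigr => pq _; rewrite expE expr1n muln0 sub0r; ring.
move: z; apply: (@sum_expn_eq0 _ _ _ tri_exp_inj) => x x0.
(* With only mu_a nonzero the first bracket is 0 and the second 1. *)
have := rel x (x ^ d.+1)%N 1%N 1%N 0%N 0%N.
rewrite [X in X + _ + _]big1 ?add0r => [|pq _]; last by rewrite ?(muln0, mul0n, subrr, oppr0, mulr0, mul0r).
rewrite [X in _ + X]big1 ?addr0 => [|pq _]; last by rewrite c3 mulr0.
move=> E0; rewrite -[RHS]E0; apply: eq_bigr => pq _; rewrite expE expr1n muln0 subr0; ring.
Qed.

End Independence.

Lemma chen_rank_McCool n d : (3 < d)%N ->
  chen_rank_is (@McCool_rel n) d.+2 #|{: chen_index n d}|.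
Proof.
move=> d_gt; split; last by move=> xs sxs; apply: chen_upper.
exists [seq chen_word x | x <- enum {: chen_index n d}]; split.
  by rewrite size_map -cardE.
split=> [w /mapP [x _ ->]|cs sz Bcs c0 c0cs].
  by apply: gen_S; left; exact: chen_word_lcs.
rewrite size_map -cardE in sz.
pose c x := nth 0 cs (enum_rank (x : chen_index n d)).
have csE : cs = [seq c x | x <- enum {: chen_index n d}].
  apply: (@eq_from_nth _ 0); first by rewrite size_map -cardE.
  move=> i; rewrite sz => li.
  rewrite -[i]/(nat_of_ord (Ordinal li)) -codomE.
  by rewrite nth_codom /c enum_valK.
rewrite csE in c0cs; case/mapP: c0cs => x _ ->.
have d0 : (0 < d)%N by exact: leq_trans d_gt.
by case: x => [[t p]|[t z]]; [exact: pair_coef0 csE Bcs _ _|exact: triple_coef0 csE Bcs _ _].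
Qed.

Local Close Scope ring_scope.

Theorem theorem1p2 (n : nat) :
  exists k0 : nat, forall k : nat, k0 <= k ->
    chen_rank_is (@McCool_rel n) k
      ((k - 1) * 'C(n, 2) + (k ^ 2 - 1) * 'C(n, 3)).
Proof.
(* The spanning argument requires d > 3, and k = d + 2. *)
exists 6 => k k6; have -> : k = (k - 2).+2 by lia.
have d_gt : 3 < k - 2 by lia.
move: (k - 2) d_gt => d d_gt.
have -> : d.+2 ^ 2 - 1 = d.+1 * d.+3 by rewrite -mulnn; lia.
by rewrite subn1 -card_chen_index; apply: chen_rank_McCool.
Qed.
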